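(* Let $E$ be a Drinfeld $A$-module over $\operatorname{Spec}K$ of finite residual characteristic with stable reduction and period lattice $\Lambda$ defined over $K$. Then there is an integer $m\geqslant0$ such that the restricted adelic monodromy representation $\rho\colon I_K\to\mathrm{GL}(\hat TE)$ maps the ramification subgroup $I_K^{m}$ to $1$. Explicitly, if $\Lambda$ is generated by elements $\lambda_1,\dots,\lambda_n$, one can take $m=\max_i\|\lambda_i\|+1$.
   Context: $\mathbb{F}_q$ finite field of characteristic $p$; $K\supset\mathbb{F}_q$ local field of characteristic $p$ with $\mathcal{O}_K$, $\mathfrak{p}_K$, normalized valuation $v$; $K^s$, $G_K$, inertia $I_K$ with upper ramification filtration $I_K^u$. $F$ global function field over $\mathbb{F}_q$, $\infty$ a place, $A$ the ring of elements regular outside $\infty$. Drinfeld modules over $K$ or $\mathcal{O}_K$ as homomorphisms $A\to R[\tau]$ (over $\mathcal{O}_K$: reduction mod $\mathfrak{p}_K$ of the same rank); characteristic homomorphism $\iota$; finite residual characteristic $\iota(A)\subset\mathcal{O}_K$, residual characteristic $\mathfrak{p}_0=\iota^{-1}(\mathfrak{p}_K)$. Stable reduction (Drinfeld's Tate uniformization): there is a Drinfeld module $D$ over $\mathcal{O}_K$ and a Galois-stable, discrete, finitely generated projective $A$-submodule $\Lambda\subset D(K^s)$ with an analytic $A$-linear surjection $e_\Lambda\colon D\to E$ with kernel $\Lambda$; ''defined over $K$'' means $\Lambda\subset D(K)$. Height on $D(K)=K$ (coordinate over $\mathcal{O}_K$): $\|\lambda\|=\max\{0,-v(\lambda)\}$.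 Restricted adelic Tate module: $\hat TE=\varprojlim_\mathfrak{n}\operatorname{Hom}_A(\mathfrak{n}^{-1}/A,E(K^s))$ over proper ideals $\mathfrak{n}\subset A$ not contained in $\mathfrak{p}_0$ (isomorphic to $\prod_{\mathfrak{p}\ne\mathfrak{p}_0}T_\mathfrak{p}E$), and $\rho$ is the action of $I_K$ on it. *)

(* Defs.v *)
From HB Require Import structures.
From mathcomp Require Export all_boot all_order all_algebra all_fingroup all_field.
From mathcomp Require Export boolp.

Set Implicit Arguments.
Unset Strict Implicit.
Unset Printing Implicit Defensive.

Import Order.TTheory GRing.Theory Num.Theory.
Local Open Scope ring_scope.

(* Valuations are total functions into a totally ordered group G; their value
   at 0 is irrelevant, v 0 = +oo being built into vge. *)

Definition vge (K : fieldType) (G : realDomainType) (v : K -> G) (c : G) (x : K)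
  : bool := (x == 0) || (c <= v x).

Record valuation (K : fieldType) (G : realDomainType) (v : K -> G) : Prop := {
  valuationM : forall x y, x != 0 -> y != 0 -> v (x * y) = v x + v y;
  valuationD : forall x y c, vge v c x -> vge v c y -> vge v c (x + y) }.

(* v maps K \ {0} onto Z: by valuationM it suffices that 1 is a value. *)
Record normalized_valuation (K : fieldType) (v : K -> int) : Prop := {
  nval_valuation : valuation v;
  nval_onto : exists2 x, x != 0 & v x = 1 }.

Definition cauchy (K : fieldType) (G : realDomainType) (v : K -> G)
    (u : nat -> K) : Prop :=
  forall c, exists N, forall m n, (N <= m)%N -> (N <= n)%N -> vge v c (u m - u n).

Definition tends_to (K : fieldType) (G : realDomainType) (v : K -> G)
    (u : nat -> K) (l : K) : Prop :=
  forall c, exists N, forall n, (N <= n)%N -> vge v c (u n - l).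

(* red : O_K -> k identifies k with O_K / p_K (arbitrary outside O_K). *)
Record residue_map (K : fieldType) (v : K -> int) (k : fieldType) (red : K -> k)
  : Prop := {
  red1 : red 1 = 1;
  redD : forall x y, vge v 0 x -> vge v 0 y -> red (x + y) = red x + red y;
  redM : forall x y, vge v 0 x -> vge v 0 y -> red (x * y) = red x * red y;
  red_eq0 : forall x, vge v 0 x -> (red x == 0) = vge v 1 x;
  red_onto : forall z, exists2 x, vge v 0 x & red x = z }.

Record local_field (K : fieldType) (v : K -> int) (k : finFieldType)
    (red : K -> k) : Prop := {
  lf_valuation : normalized_valuation v;
  lf_complete : forall u, cauchy v u -> exists l, tends_to v u l;
  lf_residue : residue_map v red }.

Record separable_closure (K Ks : fieldType) (iK : {rmorphism K -> Ks}) : Prop := {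
  sc_separable : forall x,
    exists2 p : {poly K}, separable_poly p & root (map_poly iK p) x;
  sc_closed : forall p : {poly Ks},
    separable_poly p -> (1 < size p)%N -> exists x, root p x }.

Record extends_valuation (K Ks : fieldType) (iK : {rmorphism K -> Ks})
    (v : K -> int) (vs : Ks -> rat) : Prop := {
  ev_valuation : valuation vs;
  ev_restrict : forall x, x != 0 -> vs (iK x) = (v x)%:~R }.

(* Ramification groups of a finite Galois extension L/K, in Serre's numbering;
   w is the normalized valuation of L. *)

Section FiniteRamification.

Variables (K : fieldType) (L : splittingFieldType K) (w : L -> int).

(* G_t = G_(ceil t) for rational t. *)
Definition lower_ramification (t : rat) : {set gal_of {:L}} :=
  [set g in 'Gal({:L} / 1)%g |
    `[< forall x : L, vge w 0 x ->
          (g x == x) || (t + 1 <= (w (g x - x))%:~R) >]].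

(* phi(t) = int_0^t ds / [G_0 : G_s], the integral of a step function. *)
Definition herbrand (t : rat) : rat :=
  let n := Num.truncn t in
  (\sum_(1 <= j < n.+1) #|lower_ramification j%:R|%:R
     + (t - n%:R) * #|lower_ramification n.+1%:R|%:R)
  / #|lower_ramification 0|%:R.

(* G^(phi t) = G_t *)
Definition upper_ramification (u : rat) (g : gal_of {:L}) : Prop :=
  exists t : rat, [/\ 0 <= t, herbrand t = u & g \in lower_ramification t].

End FiniteRamification.

Section AbsoluteRamification.

Variables (K Ks : fieldType) (iK : {rmorphism K -> Ks}) (vs : Ks -> rat).

Definition absolute_galois (sigma : {rmorphism Ks -> Ks}) : Prop :=
  bijective sigma /\ forall c, sigma (iK c) = iK c.

Definition inertia (sigma : {rmorphism Ks -> Ks}) : Prop :=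
  absolute_galois sigma /\
  forall x, vge vs 0 x -> sigma x = x \/ 0 < vs (sigma x - x).

(* I_K^u for u >= 0: the elements of I_K whose restriction to every finite
   Galois subextension i : L -> Ks lies in Gal(L/K)^u.  The normalized
   valuation w of L is e times the restriction of vs, where e = e(L/K). *)
Definition upper_inertia (u : rat) (sigma : {rmorphism Ks -> Ks}) : Prop :=
  inertia sigma /\
  forall (L : splittingFieldType K) (i : {rmorphism L -> Ks}) (w : L -> int),
    galois 1 {:L} ->
    (forall c : K, i c%:A = iK c) ->
    normalized_valuation w ->
    (exists2 e : nat, (0 < e)%N &
      forall x, x != 0 -> (w x)%:~R = e%:R * vs (i x)) ->
    exists2 g : gal_of {:L},
      (forall x, sigma (i x) = i (g x)) & upper_ramification w u g.

End AbsoluteRamification.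

(* A global function field over Fq is a finite extension of Fq(t). *)

Section FunctionField.

Variables (Fq : finFieldType) (F : fieldExtType {fraction {poly Fq}}).

Definition constant_field (c : Fq) : F := (tofrac c%:P)%:A.

(* Places are the normalized valuations of F; they are automatically trivial
   on the finite field Fq. *)
Definition same_place (w1 w2 : F -> int) : Prop :=
  forall x, x != 0 -> w1 x = w2 x.

Definition regular_outside (oo : F -> int) (f : F) : Prop :=
  forall w, normalized_valuation w -> ~ same_place w oo -> vge w 0 f.

Record coordinate_ring (oo : F -> int) (A : comNzRingType)
    (jA : {rmorphism A -> F}) : Prop := {
  cr_inj : injective jA;
  cr_image : forall f, regular_outside oo f <-> exists a, jA a = f }.

End FunctionField.

(* R[tau], with tau x = x^q tau, is represented on {poly R}: the coefficient
   of 'X^i is that of tau^i, and tau_mul is the multiplication. *)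

Definition tau_mul (q : nat) (R : comNzRingType) (f g : {poly R}) : {poly R} :=
  \sum_(i < size f) \sum_(j < size g) (f`_i * g`_j ^+ (q ^ i)) *: 'X^(i + j).

Definition tau_eval (q : nat) (R : comNzRingType) (f : {poly R}) (x : R) : R :=
  \sum_(i < size f) f`_i * x ^+ (q ^ i).

Section Drinfeld.

Variables (Fq : finFieldType) (F : fieldExtType {fraction {poly Fq}}).
Variables (A : comNzRingType) (jA : {rmorphism A -> F}).

(* A Drinfeld A-module over a field R, where cst : Fq -> R is the Fq-algebra
   structure of R: an Fq-algebra homomorphism A -> R[tau] with image not
   contained in R. *)
Record drinfeld_module (R : fieldType) (cst : Fq -> R) (phi : A -> {poly R})
  : Prop := {
  dm_1 : phi 1 = 1;
  dm_D : forall a b, phi (a + b) = phi a + phi b;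
  dm_M : forall a b, phi (a * b) = tau_mul #|Fq| (phi a) (phi b);
  dm_cst : forall c a, jA a = constant_field F c -> phi a = (cst c)%:P;
  dm_nonconst : exists a, (1 < size (phi a))%N }.

(* deg a = d, i.e. A/aA has q^d elements, represented by s *)
Definition has_degree (a : A) (d : nat) : Prop :=
  exists s : seq A, [/\ uniq s, size s = (#|Fq| ^ d)%N &
    forall x, exists! y, y \in s /\ exists b, x - y = a * b].

Definition has_rank (R : fieldType) (phi : A -> {poly R}) (r : nat) : Prop :=
  (0 < r)%N /\
  forall a, a != 0 ->
    exists2 d, has_degree a d & size (phi a) = (r * d).+1.

Variables (K : fieldType) (cK : {rmorphism Fq -> K}).
Variables (v : K -> int) (k : finFieldType) (red : K -> k).

Record drinfeld_module_OK (D : A -> {poly K}) : Prop := {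
  dmo_module : drinfeld_module cK D;
  dmo_integral : forall a i, vge v 0 (D a)`_i;
  dmo_reduction :
    drinfeld_module (fun c => red (cK c)) (fun a => map_poly red (D a));
  dmo_same_rank : exists r, has_rank D r /\
    has_rank (fun a => map_poly red (D a)) r }.

Definition characteristic (E : A -> {poly K}) (a : A) : K := (E a)`_0.

Definition finite_residual_characteristic (E : A -> {poly K}) : Prop :=
  forall a, vge v 0 (characteristic E a).

Definition residual_characteristic (E : A -> {poly K}) : {pred A} :=
  fun a => vge v 1 (characteristic E a).

Variables (Ks : fieldType) (iK : {rmorphism K -> Ks}) (vs : Ks -> rat).

(* The action of a on the points phi(Ks) = Ks *)
Definition act (phi : A -> {poly K}) (a : A) (x : Ks) : Ks :=
  tau_eval #|Fq| (map_poly iK (phi a)) x.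

Record submodule (D : A -> {poly K}) (Lam : Ks -> Prop) : Prop := {
  sm_0 : Lam 0;
  sm_D : forall x y, Lam x -> Lam y -> Lam (x + y);
  sm_act : forall a x, Lam x -> Lam (act D a x) }.

(* Lam is a direct summand of A^n: the map A^n -> Lam given by the generators
   g_i has the A-linear section x |-> (h_i(x))_i. *)
Definition fg_projective (D : A -> {poly K}) (Lam : Ks -> Prop) : Prop :=
  exists (n : nat) (g : 'I_n -> Ks) (h : 'I_n -> Ks -> A),
  [/\ forall i, Lam (g i),
      forall i x y, Lam x -> Lam y -> h i (x + y) = h i x + h i y,
      forall i a x, Lam x -> h i (act D a x) = a * h i x &
      forall x, Lam x -> x = \sum_i act D (h i x) (g i)].

(* Discreteness of a lattice: every ball contains finitely many elements. *)
Definition discrete (Lam : Ks -> Prop) : Prop :=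
  forall c : rat, exists s : seq Ks, forall x, Lam x -> vge vs c x -> x \in s.

Record period_lattice (D : A -> {poly K}) (Lam : Ks -> Prop) : Prop := {
  pl_submodule : submodule D Lam;
  pl_projective : fg_projective D Lam;
  pl_discrete : discrete Lam;
  pl_galois : forall sigma x, absolute_galois iK sigma -> Lam x -> Lam (sigma x) }.

(* e is (on Ks-points) an analytic A-linear surjection D -> E with kernel Lam:
   a power series over K converging everywhere.  Its linear coefficient is
   nonzero because Lam is the kernel of e as an analytic group, which is
   therefore etale. *)
Record analytic_surjection (D E : A -> {poly K}) (Lam : Ks -> Prop)
    (e : Ks -> Ks) : Prop := {
  as_analytic : exists2 s : nat -> K, s 1%N != 0 &
    forall x, tends_to vs (fun N => \sum_(i < N) iK (s i) * x ^+ i) (e x);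
  as_additive : forall x y, e (x + y) = e x + e y;
  as_linear : forall a x, e (act D a x) = act E a (e x);
  as_onto : forall y, exists x, e x = y;
  as_kernel : forall x, e x = 0 <-> Lam x }.

(* E has stable reduction, with Tate uniformization E = D / Lam *)
Record tate_uniformization (E D : A -> {poly K}) (Lam : Ks -> Prop)
    (e : Ks -> Ks) : Prop := {
  tu_good : drinfeld_module_OK D;
  tu_lattice : period_lattice D Lam;
  tu_map : analytic_surjection D E Lam e }.

Definition defined_over_base (Lam : Ks -> Prop) : Prop :=
  forall x, Lam x -> exists y, iK y = x.

Definition height (x : K) : int := if x == 0 then 0 else Num.max 0 (- v x).

Definition generated_by (D : A -> {poly K}) (Lam : Ks -> Prop)
    (n : nat) (lam : 'I_n -> K) : Prop :=
  (forall i, Lam (iK (lam i))) /\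
  forall x, Lam x -> exists a : 'I_n -> A, x = \sum_i act D (a i) (iK (lam i)).

(* idealr_closed means "proper ideal". *)
Definition admissible (E : A -> {poly K}) (n : {pred A}) : Prop :=
  idealr_closed n /\ ~ {subset n <= residual_characteristic E}.

Definition inverse_ideal (n : {pred A}) (x : F) : Prop :=
  forall a, a \in n -> exists b, jA b = x * jA a.

(* An element of lim_n Hom_A(n^-1/A, E(Ks)) is a family of A-linear maps
   T n : n^-1 -> E(Ks) vanishing on A; the values of T n outside n^-1, and T n
   for n not admissible, are irrelevant.  For n contained in m the transition
   map is the restriction along m^-1/A -> n^-1/A. *)
Record restricted_tate_module (E : A -> {poly K}) (T : {pred A} -> F -> Ks)
  : Prop := {
  tm_D : forall n x y, admissible E n -> inverse_ideal n x -> inverse_ideal n y ->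
    T n (x + y) = T n x + T n y;
  tm_linear : forall n a x, admissible E n -> inverse_ideal n x ->
    T n (jA a * x) = act E a (T n x);
  tm_vanish : forall n a, admissible E n -> T n (jA a) = 0;
  tm_compat : forall n m x, admissible E n -> admissible E m ->
    {subset n <= m} -> inverse_ideal m x -> T n x = T m x }.

Definition tate_eq (E : A -> {poly K}) (T1 T2 : {pred A} -> F -> Ks) : Prop :=
  forall n x, admissible E n -> inverse_ideal n x -> T1 n x = T2 n x.

Definition rho (sigma : {rmorphism Ks -> Ks}) (T : {pred A} -> F -> Ks)
  : {pred A} -> F -> Ks := fun n x => sigma (T n x).

Lemma rho_restricted_tate_module (E : A -> {poly K}) sigma T :
  absolute_galois iK sigma -> restricted_tate_module E T ->
  restricted_tate_module E (rho sigma T).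
Proof.
move=> [_ fixK] [TD Tlin Tvan Tcom].
have sigma_act a x : sigma (act E a x) = act E a (sigma x).
  rewrite /act /tau_eval rmorph_sum; apply: eq_bigr => i _.
  by rewrite rmorphM rmorphXn coef_map fixK.
split.
- by move=> n x y hn hx hy; rewrite /rho TD // rmorphD.
- by move=> n a x hn hx; rewrite /rho Tlin // sigma_act.
- by move=> n a hn; rewrite /rho Tvan // rmorph0.
- by move=> n m x hn hm hnm hx; rewrite /rho (Tcom n m).
Qed.

(* rho(sigma) = 1 in GL of the restricted Tate module *)
Definition rho_trivial (E : A -> {poly K}) (sigma : {rmorphism Ks -> Ks}) : Prop :=
  forall T, restricted_tate_module E T -> tate_eq E (rho sigma T) T.

End Drinfeld.

(* Main.v *)
From HB Require Import structures.
Require Import Defs.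
From mathcomp Require Import ring lra zify.

Set Implicit Arguments.
Unset Strict Implicit.
Unset Printing Implicit Defensive.

Import Order.TTheory GRing.Theory Num.Theory.
Local Open Scope ring_scope.

(* A point y of a module T n x is killed by some a in A outside the residual
   characteristic; write y = e(z), so that D_a(z) lies in Lambda. Comparing
   linear terms in e(D_a(x)) = E_a(e(x)) shows that D_a has unit constant
   coefficient, so nonzero elements of D[a] are units and inertia fixes D[a].
   Hence z may be replaced by a root of D_a(X) = lambda, lambda a generator.

   If h = -v(lambda) > 0, let L be the splitting field of D_a(X) - lambda, w its
   normalized valuation, e the ramification index and M = K(D[a]). Then M/K is
   unramified, so that e divides |Gal(L/M)| <= deg D_a =: N. If sigma in G_t moves
   z, then w(sigma z - z) = 0, while sigma(z)/z = 1 mod p_L^t; so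
   t <= -w(z) = e h / N <= h. As phi(t) <= t, sigma is not in G^u for any
   u > h. *)

(** * Valuations *)

(** The obstacle is that one m must serve every a, although the extension generated by the roots of
    D_a(X) - lambda may be wildly ramified, of degree growing with a. A balance saves uniformity:
    dividing lambda by a divides its pole order by N, while normalizing the valuation of L
    multiplies it back only by e, and e <= N. The group Gal(L/M) has order at most N because an
    automorphism over M is determined by the image of one root, the others differing from it by
    points of D[a]; the same remark makes sigma(z) - z a torsion point, hence a unit. That M/K is
    unramified is used only in this form: an element of Gal(L/K) acting nontrivially on M moves some
    integral element of M by a unit. The divisibility by e then comes from an explicit element of K
    rather than from residue field extensions. Completeness of K enters through the Galois
    invariance of w. For integral lambda, inertia already fixes the roots. The summand 1 in m comes
    from the strict inequality u > h. *)

Section Valuation.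

Variables (K : fieldType) (G : realDomainType) (v : K -> G).
Hypothesis hv : valuation v.

Lemma val1 : v 1 = 0.
Proof.
have := valuationM hv (oner_neq0 K) (oner_neq0 K).
by rewrite mulr1 => /eqP; rewrite -subr_eq0 opprD addNKr oppr_eq0 => /eqP.
Qed.

Lemma valN1 : v (-1) = 0.
Proof.
have n0 : (-1 : K) != 0 by rewrite oppr_eq0 oner_neq0.
have := valuationM hv n0 n0; rewrite mulrNN mulr1 val1 -mulr2n.
by move/esym/eqP; rewrite mulrn_eq0 /= => /eqP.
Qed.

Lemma valN x : v (- x) = v x.
Proof.
have [->|x0] := eqVneq x 0; first by rewrite oppr0.
have n0 : (-1 : K) != 0 by rewrite oppr_eq0 oner_neq0.
by rewrite -mulN1r (valuationM hv n0 x0) valN1 add0r.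
Qed.

Lemma valX x n : x != 0 -> v (x ^+ n) = v x *+ n.
Proof.
move=> x0; elim: n => [|n IH]; first by rewrite expr0 val1.
by rewrite exprS mulrS (valuationM hv x0) ?expf_neq0 // IH.
Qed.

Lemma vge0 c : vge v c 0.
Proof. by rewrite /vge eqxx. Qed.

Lemma vge_val x : vge v (v x) x.
Proof. by rewrite /vge lexx orbT. Qed.

Lemma vge_neq0 c x : x != 0 -> vge v c x = (c <= v x).
Proof. by rewrite /vge => /negPf ->. Qed.

Lemma vgeW c d x : c <= d -> vge v d x -> vge v c x.
Proof.
by move=> cd /orP[x0|dx]; apply/orP; [left|right; apply: le_trans dx].
Qed.

Lemma vgeN c x : vge v c (- x) = vge v c x.
Proof. by rewrite /vge oppr_eq0 valN. Qed.

Lemma vgeB c x y : vge v c x -> vge v c y -> vge v c (x - y).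
Proof. by move=> cx cy; apply: (valuationD hv) => //; rewrite vgeN. Qed.

Lemma vgeM c d x y : vge v c x -> vge v d y -> vge v (c + d) (x * y).
Proof.
have [->|x0] := eqVneq x 0; first by rewrite mul0r !vge0.
have [->|y0] := eqVneq y 0; first by rewrite mulr0 !vge0.
by rewrite !vge_neq0 ?mulf_neq0 // (valuationM hv) //; apply: lerD.
Qed.

Lemma vgeM0 d x y : vge v 0 x -> vge v d y -> vge v d (x * y).
Proof. by move=> hx hy; rewrite -[d]add0r; apply: vgeM. Qed.

Lemma vge_sum c (I : Type) (r : seq I) (P : pred I) (f : I -> K) :
  (forall i, P i -> vge v c (f i)) -> vge v c (\sum_(i <- r | P i) f i).
Proof.
move=> h; elim/big_rec: _ => [|i x Pi cx]; first exact: vge0.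
by apply: (valuationD hv) => //; apply: h.
Qed.

Lemma vgeX c x n : vge v c x -> vge v (c *+ n) (x ^+ n).
Proof.
move=> cx; elim: n => [|n IH]; first by rewrite expr0 mulr0n vge_neq0 ?oner_neq0 // val1.
by rewrite exprS mulrS; apply: vgeM.
Qed.

Lemma vge0X x n : vge v 0 x -> vge v 0 (x ^+ n).
Proof. by move/(vgeX n); rewrite mul0rn. Qed.

Lemma vgeDr c x y : vge v c y -> vge v c (x + y) = vge v c x.
Proof.
move=> cy; apply/idP/idP => h; last exact: (valuationD hv).
by rewrite -[x](addrK y); apply: vgeB.
Qed.

Lemma vge_unit x y d : x != 0 -> v x = 0 -> vge v d (x * y) = vge v d y.
Proof.
move=> x0 vx; have [->|y0] := eqVneq y 0; first by rewrite mulr0.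
by rewrite !vge_neq0 ?mulf_neq0 // (valuationM hv) // vx add0r.
Qed.

Lemma vge_all_eq0 x : (forall c, vge v c x) -> x = 0.
Proof.
move=> h; apply/eqP; case/orP: (h (v x + 1)) => //.
by rewrite gerDl ler10.
Qed.

Lemma tends_to_unique u l1 l2 : tends_to v u l1 -> tends_to v u l2 -> l1 = l2.
Proof.
move=> h1 h2; apply/eqP; rewrite -subr_eq0; apply/eqP/vge_all_eq0 => c.
have [N1 {}h1] := h1 c; have [N2 {}h2] := h2 c.
have -> : l1 - l2 = (u (maxn N1 N2) - l2) - (u (maxn N1 N2) - l1) by ring.
by apply: vgeB; [apply: h2; rewrite leq_maxr | apply: h1; rewrite leq_maxl].
Qed.

Lemma tends_to_vge u l c N :
  tends_to v u l -> (forall n, (N <= n)%N -> vge v c (u n)) -> vge v c l.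
Proof.
move=> h hu; have [N1 {}h] := h c.
have -> : l = u (maxn N N1) - (u (maxn N N1) - l) by ring.
by apply: vgeB; [apply: hu; rewrite leq_maxl | apply: h; rewrite leq_maxr].
Qed.

End Valuation.

Lemma extends_vge (K Ks : fieldType) (iK : {rmorphism K -> Ks}) (v : K -> int)
    (vs : Ks -> rat) c x :
  extends_valuation iK v vs -> vge vs c%:~R (iK x) = vge v c x.
Proof.
move=> h; rewrite /vge fmorph_eq0; have [//|x0] := eqVneq x 0.
by rewrite (ev_restrict h) // ler_int.
Qed.

Lemma arch_rat (x : rat) : exists n : nat, x <= n%:R.
Proof. by exists (Num.truncn x).+1; rewrite ltW // truncnS_gt. Qed.

(** * Uniqueness of the extension of a complete valuation *)

Section UniqueExtension.

Variables (K : fieldType) (v : K -> int) (L : fieldExtType K).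
Hypothesis complete_v : forall u, cauchy v u -> exists l, tends_to v u l.

(* By completeness, a finite-dimensional subspace is closed. *)
Lemma span_distance_bounded (u : L -> rat) (X : seq L) (x : L) :
  extends_valuation (in_alg L) v u -> x \notin <<X>>%VS ->
  exists C : rat, forall y, y \in <<X>>%VS -> u (x + y) <= C.
Proof.
move=> hu; have uv := ev_valuation hu.
elim: X x => [|b X IH] x.
  by move=> _; exists (u x) => y; rewrite span_nil memv0 => /eqP ->; rewrite addr0.
have [bX|bX] := boolP (b \in <<X>>%VS).
  suff -> : <<b :: X>>%VS = <<X>>%VS by apply: IH.
  by rewrite span_cons; apply/addv_idPr; rewrite -memvE.
move=> xbX; apply: contrapT => hn.
have hN (N : nat) : exists cy : K * L,
    cy.2 \in <<X>>%VS /\ N%:R < u (x + cy.1 *: b + cy.2).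
  apply: contrapT => hN; apply: hn; exists N%:R => y.
  rewrite span_cons => /memv_addP[_ /vlineP[c ->] [y' y'X ->]].
  rewrite leNgt; apply/negP => hlt; apply: hN; exists (c, y') => /=.
  by rewrite -addrA.
have {hn hN} [f hf] := choice hN.
have [C hC] := IH b bX.
have nz c y : y \in <<X>>%VS -> x + c *: b + y != 0.
  move=> yX; apply: contra xbX => /eqP/(congr1 (fun t => t - y - c *: b)).
  rewrite addrK addrK sub0r => ->; rewrite span_cons rpredB ?rpredN //.
    by apply: (subvP (addvSr _ _)).
  by apply: (subvP (addvSl _ _)); apply: memvZ; apply: memv_line.
have scaleE d z : d *: z = (in_alg L d) * z :> L by rewrite /= mulr_algl.
(* The difference of two chosen elements is [d] times the sum of [b] and an element of the span of
   [X]. As [C] bounds the valuation of that sum, a large valuation must come from [d]. *)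
have cau : cauchy v (fun N => (f N).1).
  move=> c0; have [N hNc] := arch_rat (c0%:~R + C).
  exists N => m n Nm Nn; rewrite /vge; have [//|d0 /=] := eqVneq.
  set d := _ - _ in d0 *.
  have [ym um] := hf m; have [yn un] := hf n.
  have bnd : vge u N%:R (d *: (b + d^-1 *: ((f m).2 - (f n).2))).
    have -> : d *: (b + d^-1 *: ((f m).2 - (f n).2)) =
       (x + (f m).1 *: b + (f m).2) - (x + (f n).1 *: b + (f n).2).
      by rewrite scalerDr scalerA divff // scale1r /d scalerBl; ring.
    by apply: vgeB => //; apply: vgeW (vge_val _ _); apply/ltW;
       [apply: le_lt_trans um | apply: le_lt_trans un]; rewrite ler_nat.
  have y''X : d^-1 *: ((f m).2 - (f n).2) \in <<X>>%VS by rewrite memvZ // rpredB.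
  have b0 : b + d^-1 *: ((f m).2 - (f n).2) != 0.
    by apply: contra bX; rewrite addr_eq0 => /eqP ->; rewrite rpredN.
  have di0 : in_alg L d != 0 by rewrite fmorph_eq0.
  move: bnd; rewrite scaleE vge_neq0 ?mulf_neq0 // (valuationM uv) //.
  rewrite (ev_restrict hu) // -(ler_int rat).
  have := hC _ y''X; lra.
have [c hc] := complete_v cau.
(* The limit [c] now replaces the varying coefficients: [x + c *: b] comes arbitrarily close to the
   span of [X], against the induction hypothesis. *)
have xc : x + c *: b \notin <<X>>%VS.
  by apply/negP => h; have := nz c (- (x + c *: b)); rewrite rpredN subrr eqxx; move/(_ h).
have [C' hC'] := IH _ xc.
have [n1 hn1] := arch_rat (C' + 1).
have [n2 hn2] := arch_rat (C' + 1 - u b).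
have [N3 hN3] := hc n2%:Z.
pose N := maxn n1 N3; have [yN uN] := hf N.
have := hC' _ yN; apply/negP; rewrite -ltNge.
suff : vge u (C' + 1) (x + c *: b + (f N).2).
  rewrite vge_neq0 ?nz //; lra.
have -> : x + c *: b + (f N).2 =
   (x + (f N).1 *: b + (f N).2) - ((f N).1 - c) *: b.
  by rewrite scalerBl opprB; ring.
apply: vgeB => //.
  apply: vgeW (vge_val _ _); apply/ltW; apply: le_lt_trans uN.
  by apply: le_trans hn1 _; rewrite ler_nat leq_maxl.
rewrite scaleE -[C' + 1](subrK (u b)); apply: vgeM => //; last exact: vge_val.
apply: (@vgeW _ _ _ _ n2%:~R) => //.
by rewrite (extends_vge _ _ hu); apply: hN3; rewrite leq_maxr.
Qed.

(** Induction on the spanning list. If [c *: b + y] is [u1]-small, the distance from [b] to the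
    remaining span forces [v c] to be large, so [c *: b] and then [y] are [u1]-small. The value
    [v c] is common to both extensions, and the induction hypothesis treats [y]. *)
Lemma extensions_equivalent (u1 u2 : L -> rat) (X : seq L) :
  extends_valuation (in_alg L) v u1 -> extends_valuation (in_alg L) v u2 ->
  exists C : rat, forall x r, x \in <<X>>%VS -> vge u1 r x -> vge u2 (r - C) x.
Proof.
move=> h1 h2; have v1 := ev_valuation h1; have v2 := ev_valuation h2.
elim: X => [|b X [C1 IH]].
  by exists 0 => x r; rewrite span_nil memv0 => /eqP -> _; apply: vge0.
have [bX|bX] := boolP (b \in <<X>>%VS).
  suff -> : <<b :: X>>%VS = <<X>>%VS by exists C1.
  by rewrite span_cons; apply/addv_idPr; rewrite -memvE.
have [C2 hC2] := span_distance_bounded h1 bX.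
exists (`|C1| + `|C2| + `|u1 b| + `|u2 b|) => x r.
have := ler_norm C1; have := ler_norm C2; have := ler_norm (u1 b).
have := ler_norm (u2 b); have := ler_norm (- u1 b); have := ler_norm (- u2 b).
have := normr_ge0 (u1 b); have := normr_ge0 (u2 b); rewrite !normrN.
have := normr_ge0 C1; have := normr_ge0 C2.
set a1 := `|C1|; set a2 := `|C2|; set a3 := `|u1 b|; set a4 := `|u2 b|.
move=> ? ? ? ? ? ? ? ? ? ?.
rewrite span_cons => /memv_addP[_ /vlineP[c ->] [y yX ->]].
have [->|c0] := eqVneq c 0.
  by rewrite scale0r add0r => /(IH _ _ yX); apply: vgeW; lra.
move=> hx.
have b0 : b != 0 by apply: contra bX => /eqP ->; apply: mem0v.
have ci0 : in_alg L c != 0 by rewrite fmorph_eq0.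
have cb : c *: b = in_alg L c * b by rewrite /= mulr_algl.
have yE : c *: b + y = in_alg L c * (b + c^-1 *: y).
  by rewrite /= mulr_algl scalerDr scalerA divff // scale1r.
have y'X : c^-1 *: y \in <<X>>%VS by rewrite memvZ.
have by0 : b + c^-1 *: y != 0.
  by apply: contra bX; rewrite addr_eq0 => /eqP ->; rewrite rpredN.
have hc : r <= (v c)%:~R + C2.
  move: hx; rewrite yE vge_neq0 ?mulf_neq0 // (valuationM v1) // (ev_restrict h1) //.
  by have := hC2 _ y'X; lra.
have hy : vge u1 (r - a2 - a3) y.
  have -> : y = c *: b + y - c *: b by ring.
  apply: vgeB => //; first by apply: vgeW hx; lra.
  rewrite cb vge_neq0 ?mulf_neq0 // (valuationM v1) // (ev_restrict h1) //; lra.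
apply: (valuationD v2).
  rewrite cb vge_neq0 ?mulf_neq0 // (valuationM v2) // (ev_restrict h2) //; lra.
by apply: vgeW (IH _ _ yX hy); lra.
Qed.

(** A strict inequality at [x] grows linearly along the powers [x ^+ n] and outruns the constant of
    [extensions_equivalent]. *)
Lemma extension_unique (u1 u2 : L -> rat) (x : L) :
  extends_valuation (in_alg L) v u1 -> extends_valuation (in_alg L) v u2 ->
  x != 0 -> u1 x = u2 x.
Proof.
move=> h1 h2 x0; apply/eqP; rewrite eq_le.
suff le (w1 w2 : L -> rat) : extends_valuation (in_alg L) v w1 ->
    extends_valuation (in_alg L) v w2 -> w1 x <= w2 x by rewrite !le.
move=> {h1 h2} h1 h2; rewrite leNgt; apply/negP => lt21.
have [C hC] := extensions_equivalent (vbasis {:L}) h1 h2.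
have d0 : 0 < w1 x - w2 x by rewrite subr_gt0.
have [n hn] := arch_rat ((C + 1) / (w1 x - w2 x)).
have := hC (x ^+ n) (w1 x *+ n); rewrite (span_basis (vbasisP _)) memvf.
rewrite !vge_neq0 ?expf_neq0 // (valX (ev_valuation h1)) // (valX (ev_valuation h2)) //.
move=> /(_ isT (lexx _)).
move: hn; rewrite ler_pdivrMr // -(mulr_natl (w1 x)) -(mulr_natl (w2 x)) mulrBr; lra.
Qed.

End UniqueExtension.

(** * Skew polynomials *)

Lemma pnat_card_finField (Fq : finFieldType) (R : nzRingType)
    (f : {rmorphism Fq -> R}) i : [pchar R].-nat (#|Fq| ^ i)%N.
Proof.
have [p p_pr pF] := finPcharP Fq.
rewrite (card_pprimeChar pF) -expnM pnatX; apply/orP; left.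
rewrite pnatE //; exact: (rmorph_pchar f pF).
Qed.

Section Act.

Variables (Fq : finFieldType) (K : fieldType).
Variables (cK : {rmorphism Fq -> K}).

Section OnePoint.

Variables (L : fieldType) (iL : {rmorphism K -> L}).

Notation q := #|Fq|.

(** The field [L] is arbitrary because the same polynomial is evaluated both in [Ks] and in the
    finite extension containing the roots of D_a(X) - lambda. *)
Definition skew_eval (f : {poly K}) (x : L) : L := tau_eval q (map_poly iL f) x.

Lemma frobeniusD i (x y : L) : (x + y) ^+ (q ^ i) = x ^+ (q ^ i) + y ^+ (q ^ i).
Proof. by apply: exprDn_pchar; apply: (pnat_card_finField (iL \o cK)). Qed.

Lemma frobenius_sum i (I : Type) (r : seq I) (F : I -> L) :
  (\sum_(j <- r) F j) ^+ (q ^ i) = \sum_(j <- r) F j ^+ (q ^ i).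
Proof.
elim: r => [|j r IH]; last by rewrite !big_cons frobeniusD IH.
by rewrite !big_nil expr0n expn_eq0 (gtn_eqF (ltnW (finNzRing_gt1 Fq))).
Qed.

Lemma skew_evalE (f : {poly K}) x n : (size f <= n)%N ->
  skew_eval f x = \sum_(i < n) iL f`_i * x ^+ (q ^ i).
Proof.
move=> sf; rewrite /skew_eval /tau_eval size_map_poly.
rewrite (big_ord_widen _ (fun i => (map_poly iL f)`_i * x ^+ (q ^ i)) sf) big_mkcond.
apply: eq_bigr => i _; rewrite coef_map; case: ltnP => // ge.
by rewrite nth_default // rmorph0 mul0r.
Qed.

Lemma skew_evalD (f g : {poly K}) x :
  skew_eval (f + g) x = skew_eval f x + skew_eval g x.
Proof.
pose n := maxn (size f) (size g).
rewrite !(@skew_evalE _ _ n) ?leq_maxl ?leq_maxr ?(leq_trans (size_polyD _ _)) //.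
by rewrite -big_split; apply: eq_bigr => i _ /=; rewrite coefD rmorphD mulrDl.
Qed.

Lemma skew_eval0l x : skew_eval 0 x = 0.
Proof. by rewrite (@skew_evalE _ _ 0) ?size_poly0 // big_ord0. Qed.

Lemma skew_eval_sum (I : Type) (r : seq I) (F : I -> {poly K}) x :
  skew_eval (\sum_(j <- r) F j) x = \sum_(j <- r) skew_eval (F j) x.
Proof.
by elim: r => [|j r IH]; rewrite ?big_nil ?skew_eval0l // !big_cons skew_evalD IH.
Qed.

Lemma skew_evalZXn c k x : skew_eval (c *: 'X^k) x = iL c * x ^+ (q ^ k).
Proof.
rewrite (@skew_evalE _ _ k.+1); last first.
  by rewrite (leq_trans (size_scale_leq _ _)) // size_polyXn.
rewrite big_ord_recr /= coefZ coefXn eqxx mulr1 big1 ?add0r // => i _.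
by rewrite coefZ coefXn (ltn_eqF (ltn_ord i)) mulr0 rmorph0 mul0r.
Qed.

Lemma skew_eval_additive f x y : skew_eval f (x + y) = skew_eval f x + skew_eval f y.
Proof.
rewrite /skew_eval /tau_eval -big_split; apply: eq_bigr => i _ /=.
by rewrite frobeniusD mulrDr.
Qed.

Lemma skew_evalr0 f : skew_eval f 0 = 0.
Proof. by apply: (addrI (skew_eval f 0)); rewrite -skew_eval_additive !addr0. Qed.

Lemma skew_evalN f x : skew_eval f (- x) = - skew_eval f x.
Proof. by apply: (addrI (skew_eval f x)); rewrite -skew_eval_additive !subrr skew_evalr0. Qed.

Lemma skew_evalB f x y : skew_eval f (x - y) = skew_eval f x - skew_eval f y.
Proof. by rewrite skew_eval_additive skew_evalN. Qed.

Lemma skew_eval_sumr f (I : Type) (r : seq I) (F : I -> L) :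
  skew_eval f (\sum_(j <- r) F j) = \sum_(j <- r) skew_eval f (F j).
Proof.
elim: r => [|j r IH]; rewrite ?big_nil ?skew_evalr0 // !big_cons.
by rewrite skew_eval_additive IH.
Qed.

Lemma skew_eval_tau_mul f g x : skew_eval (tau_mul q f g) x = skew_eval f (skew_eval g x).
Proof.
rewrite /tau_mul skew_eval_sum [RHS](skew_evalE _ (leqnn _)).
apply: eq_bigr => i _; rewrite skew_eval_sum [in RHS](skew_evalE _ (leqnn _)).
rewrite frobenius_sum mulr_sumr; apply: eq_bigr => j _.
by rewrite skew_evalZXn rmorphM rmorphXn exprMn -!mulrA -exprM expnD [(_ * q ^ j)%N]mulnC.
Qed.

End OnePoint.

Lemma skew_eval_morph (L1 L2 : fieldType) (i1 : {rmorphism K -> L1})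
    (i2 : {rmorphism K -> L2}) (s : {rmorphism L1 -> L2}) f x :
  (forall c, s (i1 c) = i2 c) -> s (skew_eval i1 f x) = skew_eval i2 f (s x).
Proof.
move=> si; rewrite !(skew_evalE _ _ (leqnn _)) rmorph_sum; apply: eq_bigr => i _.
by rewrite rmorphM rmorphXn si.
Qed.

Definition skew_poly (f : {poly K}) : {poly K} :=
  \sum_(i < size f) f`_i *: 'X^(#|Fq| ^ i).

Lemma horner_skew_poly (L : fieldType) (iL : {rmorphism K -> L}) f x :
  (map_poly iL (skew_poly f)).[x] = skew_eval iL f x.
Proof.
rewrite (skew_evalE _ _ (leqnn _)) rmorph_sum horner_sum; apply: eq_bigr => i _.
by rewrite /= map_polyZ map_polyXn hornerZ hornerXn.
Qed.

Lemma size_skew_poly f : f != 0 -> size (skew_poly f) = (#|Fq| ^ (size f).-1).+1.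
Proof.
move=> f0; rewrite /skew_poly; have := lead_coef_eq0 f; rewrite (negPf f0) /lead_coef.
have := f0; rewrite -size_poly_gt0; case: (size f) => // n _ /= fn.
rewrite big_ord_recr /= addrC size_polyDl size_scale ?fn // size_polyXn //.
apply: (leq_ltn_trans (size_sum _ _ _)); rewrite ltnS; apply/bigmax_leqP => i _.
rewrite (leq_trans (size_scale_leq _ _)) // size_polyXn ltn_exp2l ?finNzRing_gt1 //.
Qed.

(** Positive powers of q vanish in [K]. A constant derivative makes f(X) - lambda separable for
    every lambda once the constant coefficient of [f] is nonzero. *)
Lemma deriv_skew_poly f : (skew_poly f)^`() = (f`_0)%:P.
Proof.
have [->|f0] := eqVneq f 0; first by rewrite /skew_poly size_poly0 big_ord0 coef0 deriv0.
rewrite /skew_poly linear_sum /=; move: f0; rewrite -size_poly_gt0; case: (size f) => // n _.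
rewrite big_ord_recl /= expn0 derivZ derivX alg_polyC big1 ?addr0 // => i _.
rewrite derivZ derivXn; have [p p_pr pF] := finPcharP Fq.
have pK := rmorph_pchar cK pF.
have -> : 'X^((#|Fq| ^ bump 0 i).-1) *+ (#|Fq| ^ bump 0 i) = 0 :> {poly K}; last first.
  by rewrite scaler0.
rewrite -mulr_natr -polyC_natr.
have -> : (#|Fq| ^ bump 0 i)%:R = 0 :> K; last by rewrite polyC0 mulr0.
apply/eqP; rewrite natrX /bump /= add1n exprS mulf_eq0; apply/orP; left.
rewrite -(rmorph_nat cK) fmorph_eq0 -(dvdn_pcharf pF).
have [d dE] : exists d, #|Fq| = (p ^ d)%N by eexists; exact: card_pprimeChar pF.
by have := finNzRing_gt1 Fq; rewrite dE; case: d {dE} => // d _; rewrite expnS dvdn_mulr.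
Qed.

End Act.

(** * Valuations of torsion points *)

Lemma val_dominant (K : fieldType) (G : realDomainType) (v : K -> G) c x y :
  valuation v -> x != 0 -> v x < c -> vge v c y -> x + y != 0 /\ v (x + y) = v x.
Proof.
move=> hv x0 xc cy; have ncx : ~~ vge v c (x + y).
  by rewrite vgeDr // vge_neq0 // -ltNge.
have xy0 : x + y != 0 by apply: contra ncx => /eqP ->; apply: vge0.
split=> //; apply/eqP; rewrite eq_le; apply/andP; split.
  have : vge v (Order.min c (v (x + y))) x.
    by rewrite -(vgeDr hv x (vgeW _ cy)) ?ge_min ?lexx // vge_neq0 // ge_min lexx orbT.
  rewrite vge_neq0 // ge_min => /orP[|//].
  by rewrite leNgt xc.
by rewrite -vge_neq0 // vgeDr ?vge_val //; apply: vgeW cy; apply: ltW.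
Qed.

(* The kernel of such an [f] is finite etale over the valuation ring. *)
Record unit_skew_poly (K : fieldType) (v : K -> int) (f : {poly K}) : Prop := {
  usp_integral : forall i, vge v 0 f`_i;
  usp_const_neq0 : f`_0 != 0;
  usp_const : v f`_0 = 0;
  usp_lead : v (lead_coef f) = 0 }.

Section SkewValuation.

Variables (Fq : finFieldType) (K : fieldType) (v : K -> int).
Variables (L : fieldType) (iL : {rmorphism K -> L}) (u : L -> rat).
Hypothesis hu : extends_valuation iL v u.
Let uv := ev_valuation hu.

Variable f : {poly K}.
Hypothesis hf : unit_skew_poly v f.

Notation q := #|Fq|.
Notation ev := (skew_eval Fq iL f).

Lemma usp_neq0 : f != 0.
Proof. by apply: contra (usp_const_neq0 hf) => /eqP ->; rewrite coef0. Qed.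

Lemma usp_coef i : vge u 0 (iL f`_i).
Proof. by rewrite (extends_vge 0 _ hu); apply: usp_integral. Qed.

Lemma skew_eval_pole z : z != 0 -> u z < 0 ->
  ev z != 0 /\ u (ev z) = (q ^ (size f).-1)%:R * u z.
Proof.
move=> z0 uz; have f0 := usp_neq0.
have sf : size f = (size f).-1.+1 by rewrite prednK // size_poly_gt0.
rewrite (skew_evalE Fq iL z (leqnn _)) sf big_ord_recr /=.
set d := (size f).-1; rewrite -[f`_d]/(lead_coef f).
have lf0 : iL (lead_coef f) != 0 by rewrite fmorph_eq0 lead_coef_eq0.
have uq : u (iL (lead_coef f) * z ^+ (q ^ d)) = (q ^ d)%:R * u z.
  rewrite (valuationM uv) ?expf_neq0 // (valX uv) //.
  rewrite (ev_restrict hu) ?lead_coef_eq0 // (usp_lead hf) add0r.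
  by rewrite [RHS]mulr_natl.
have x0 : iL (lead_coef f) * z ^+ (q ^ d) != 0 by rewrite mulf_neq0 // expf_neq0.
(* As [u z < 0] and q^i <= q^d - 1 for i < d, this bounds all lower terms from below; it exceeds the
   valuation of the top term by [- u z]. *)
pose c := (q ^ d)%:R * u z - u z.
rewrite -uq [X in X != 0 /\ u X = _]addrC.
apply: (@val_dominant _ _ _ c) => //; first by rewrite uq /c; lra.
apply: vge_sum => // i _; apply: vgeM0 => //; first exact: usp_coef.
apply: vgeW (vgeX uv _ (vge_val u z)).
rewrite /c -[leRHS]mulr_natl -[X in _ - X]mul1r -mulrBl.
apply: ler_wnM2r; first exact: ltW.
rewrite lerBrDr natr1 ler_nat.
by rewrite ltn_exp2l // finNzRing_gt1.
Qed.

Lemma skew_eval_integral z : vge u 0 (ev z) -> vge u 0 z.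
Proof.
have [->|z0] := eqVneq z 0; first by rewrite vge0.
rewrite [vge u 0 z]vge_neq0 //; have [//|uz] := leP 0 (u z).
have [e0 ue] := skew_eval_pole z0 uz; rewrite vge_neq0 // ue pmulr_rge0 //.
  by rewrite leNgt uz.
by rewrite ltr0n expn_gt0 (ltnW (finNzRing_gt1 Fq)).
Qed.

(** A pole is excluded by [skew_eval_integral]. If [u z] were positive, the linear term, with unit
    coefficient, would have valuation [u z] against at least twice that for the rest, so the terms
    could not cancel. *)
Lemma skew_root_unit z : z != 0 -> ev z = 0 -> u z = 0.
Proof.
move=> z0 ez; have : 0 <= u z.
  by rewrite -vge_neq0 //; apply: skew_eval_integral; rewrite ez vge0.
rewrite le_eqVlt => /orP[/eqP //|uz].
have f0 := usp_neq0; move: ez; rewrite (skew_evalE Fq iL z (leqnn _)).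
have : (0 < size f)%N by rewrite size_poly_gt0.
case: (size f) => // n _; rewrite big_ord_recl expn0 expr1.
have a0 : iL f`_0 != 0 by rewrite fmorph_eq0 (usp_const_neq0 hf).
have ua : u (iL f`_0 * z) = u z.
  by rewrite (valuationM uv) // (ev_restrict hu) ?(usp_const hf) ?add0r // (usp_const_neq0 hf).
set y := \sum_(i < n) _.
suff hy : vge u (u z + u z) y.
  have [|nz _] := val_dominant uv (mulf_neq0 a0 z0) _ hy; first by rewrite ua; lra.
  by move=> e0; rewrite e0 eqxx in nz.
apply: vge_sum => // i _; apply: vgeM0 => //; first exact: usp_coef.
apply: vgeW (vgeX uv _ (vge_val u z)).
rewrite -mulr2n ler_wpMn2l // ?ltW //.
by rewrite -[2%N]expn1 (leq_trans (finNzRing_gt1 Fq)) // /bump -{1}[#|Fq|]expn1 leq_exp2l ?finNzRing_gt1.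
Qed.

End SkewValuation.

Lemma separable_splits (Ks : fieldType) (f : {poly Ks}) :
  (forall p : {poly Ks}, separable_poly p -> (1 < size p)%N -> exists x, root p x) ->
  separable_poly f -> exists s : seq Ks, f %= \prod_(x <- s) ('X - x%:P).
Proof.
move=> closed; have [n] := ubnP (size f); elim: n f => // n IH f; rewrite ltnS => sn sep.
have f0 : f != 0 by apply: separable_poly_neq0.
have [sf|sf] := leqP (size f) 1.
  exists [::]; rewrite big_nil -size_poly_eq1 eqn_leq sf size_poly_gt0 f0 //.
have [x /factor_theorem[g fE]] := closed f sep sf.
have g0 : g != 0 by apply: contra f0; rewrite fE => /eqP ->; rewrite mul0r.
have [s gs] : exists s : seq Ks, g %= \prod_(x <- s) ('X - x%:P).
  apply: IH; last by move: sep; rewrite fE separable_mul => /and3P[].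
  by move: sn; rewrite fE size_mul ?polyXsubC_eq0 // size_XsubC addn2.
by exists (x :: s); rewrite big_cons fE mulrC eqp_mul2l ?polyXsubC_eq0.
Qed.

(** * Splitting fields *)

(** One element is adjoined at a time, through an annihilating polynomial of least size, and
    [baseFieldType] turns the tower into an extension of the bottom field. The finite extension must
    be a type of its own because [upper_inertia] quantifies over such types. *)
Lemma algebraic_extension (K Ks : fieldType) (iK : {rmorphism K -> Ks}) (s : seq Ks) :
  (forall x, x \in s -> exists2 p : {poly K}, p != 0 & root (map_poly iK p) x) ->
  exists (L : fieldExtType K) (i : {rmorphism L -> Ks}) (s1 : seq L),
    (forall c, i c%:A = iK c) /\ map i s1 = s.
Proof.
elim: s K iK => [|x s IH] K iK hs.
  exists (GRing.regular K : fieldExtType K).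
  pose i : {rmorphism (GRing.regular K) -> Ks} := iK.
  by exists i, [::]; split=> // c; rewrite -[c in RHS]mulr1.
pose P n := `[< exists p : {poly K}, [/\ p != 0, root (map_poly iK p) x & size p = n] >].
have exP : exists n, P n.
  have [p p0 px] := hs x (mem_head _ _).
  by exists (size p); apply/asboolP; exists p.
case: (ex_minnP exP) => n /asboolP[p [p0 px <-{n}]] pmin.
have irr_p : irreducible_poly p.
  apply/(subfx_irreducibleP px p0) => r rx r0.
  by apply: pmin; apply/asboolP; exists r.
pose K1 : fieldExtType K := SubFieldExtType px irr_p.
pose i1 : {rmorphism K1 -> Ks} := @subfx_inj _ _ iK x p.
have i1E c : i1 c%:A = iK c by apply: subfx_inj_base.
have [y iy] : exists y, i1 y = x by exists (subfx_root iK x p); apply: subfx_inj_root.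
have alg1 z : z \in s -> exists2 r : {poly K1}, r != 0 & root (map_poly i1 r) z.
  move=> zs; have [r r0 rz] := hs z (mem_behead (zs : z \in behead (x :: s))).
  exists (map_poly (in_alg K1) r); first by rewrite map_poly_eq0.
  by rewrite -map_poly_comp (eq_map_poly i1E).
have [L [i [s1 [iE is1]]]] := IH K1 i1 alg1.
exists (baseFieldType L : fieldExtType K).
pose i0 : {rmorphism (baseFieldType L) -> Ks} := i.
exists i0, ((y%:A : L) :: s1 : seq (baseFieldType L)); split.
  by move=> c; rewrite -i1E -iE.
by rewrite /= -is1 /i0 iE iy.
Qed.

Lemma generated_extension (K Ks : fieldType) (iK : {rmorphism K -> Ks}) (s : seq Ks) :
  (forall x, x \in s -> exists2 p : {poly K}, p != 0 & root (map_poly iK p) x) ->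
  exists (L : fieldExtType K) (i : {rmorphism L -> Ks}) (s1 : seq L),
    [/\ forall c, i c%:A = iK c, map i s1 = s & <<1 & s1>>%VS = fullv].
Proof.
move=> /algebraic_extension[L [i [s1 [iE is1]]]].
pose M := <<1 & s1>>%AS; pose toL := linfun (vsval : subvs_of M -> L).
have [s2 s2E] : exists s2, map toL s2 = s1.
  exists (map (vsproj _) s1); rewrite -map_comp map_id_in // => y ys.
  by rewrite /= lfunE /= vsprojK ?seqv_sub_adjoin.
pose i2 : {rmorphism (subvs_of M) -> Ks} := i \o (vsval : subvs_of M -> L).
exists (subvs_of M : fieldExtType K), i2, s2; split.
- by move=> c; rewrite /i2 /= -iE; congr (i _); exact: (rmorph_alg (vsval : {lrmorphism subvs_of M -> L})).
- rewrite -is1 -s2E -map_comp; apply: eq_map => y.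
  by rewrite /i2 /= lfunE.
- apply/vspaceP=> u; rewrite memvf.
  set Lzs := <<1 & s2>>%VS; pose Lys := (toL @: Lzs)%VS.
  have: val u \in Lys by rewrite /Lys aimg_adjoin_seq aimg1 s2E (valP u).
  by case/memv_imgP=> w Lzs_w; rewrite lfunE => /val_inj->.
Qed.

(** The roots [s1] and the fact that they generate [L] are kept in the conclusion so that
    automorphisms can be recognized by their values on the roots. *)
Lemma splitting_extension (K Ks : fieldType) (iK : {rmorphism K -> Ks})
    (f : {poly K}) (s : seq Ks) :
  separable_poly f -> map_poly iK f %= \prod_(x <- s) ('X - x%:P) ->
  exists (L : splittingFieldType K) (i : {rmorphism L -> Ks}) (s1 : seq L),
    [/\ galois 1 {:L}, forall c, i c%:A = iK c, map i s1 = s & <<1 & s1>>%VS = fullv].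
Proof.
move=> sep fs.
have alg x : x \in s -> exists2 p : {poly K}, p != 0 & root (map_poly iK p) x.
  move=> xs; exists f; first exact: separable_poly_neq0.
  by rewrite (eqp_root fs) root_prod_XsubC.
have [L0 [i [s1 [iE is1 gen]]]] := generated_extension alg.
have fL : map_poly (in_alg L0) f %= \prod_(x <- s1) ('X - x%:P).
  rewrite -(eqp_map i) -map_poly_comp (eq_map_poly iE) rmorph_prod /=.
  rewrite (eq_bigr (fun x => 'X - (i x)%:P)); last first.
    by move=> x _; rewrite rmorphB /= map_polyX map_polyC.
  by rewrite -(big_map i predT (fun x => 'X - x%:P)) is1.
have fP : map_poly (in_alg L0) f \is a polyOver 1%VS.
  by apply/polyOverP => j; rewrite coef_map memvZ ?mem1v.
have ax : splitting_field_axiom L0.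
  by exists (map_poly (in_alg L0) f) => //; exists s1.
pose L : splittingFieldType K := HB.pack L0 (FieldExt_isSplittingField.Build K L0 ax).
exists L, i, s1; split=> //.
apply/splitting_galoisField; exists (map_poly (in_alg L0) f); split=> //.
  by rewrite separable_map.
by exists s1.
Qed.

(** * Ramification of Galois extensions *)

(* Artin's independence of characters, modulo the maximal ideal of [w]. *)
Lemma characters_independent (L : fieldType) (G : realDomainType) (w : L -> G)
    (I : eqType) (chi : I -> L -> L) (Y : L -> Prop) (m : G) (i0 : I) (s : seq I) :
  valuation w -> Y 1 -> (forall x y, Y x -> Y y -> Y (x * y)) ->
  (forall i, chi i 1 = 1) -> (forall i x y, chi i (x * y) = chi i x * chi i y) ->
  (forall i y, Y y -> vge w 0 (chi i y)) ->
  (forall i, i \in s -> exists c,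
     [/\ Y c, chi i0 c - chi i c != 0 & w (chi i0 c - chi i c) = 0]) ->
  forall c : I -> L, ~~ vge w m (c i0) ->
  exists2 y, Y y & ~~ vge w m (\sum_(i <- i0 :: s) c i * chi i y).
Proof.
move=> hw Y1 YM chi1 chiM chiY; elim: s => [|i1 s IH] sep c c0.
  by exists 1 => //; rewrite big_seq1 chi1 mulr1.
have [d [Yd d0 wd]] := sep i1 (mem_head _ _).
(* These coefficients annihilate [chi i1] and multiply the coefficient of [i0] by a unit, so the
   induction hypothesis applies. The new sum is the old one at [d * y] minus [chi i1 d] times the
   old one at [y]. *)
have [y Yy hy] : exists2 y, Y y &
    ~~ vge w m (\sum_(i <- i0 :: s) (c i * (chi i d - chi i1 d)) * chi i y).
  apply: IH; last by rewrite mulrC (vge_unit hw).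
  by move=> i si; apply: sep; rewrite inE si orbT.
have [bad|] := boolP (vge w m (\sum_(i <- i0 :: i1 :: s) c i * chi i y)); last by exists y.
exists (d * y); first exact: YM.
apply: contra hy => good.
have -> : \sum_(i <- i0 :: s) (c i * (chi i d - chi i1 d)) * chi i y =
    \sum_(i <- i0 :: i1 :: s) c i * chi i (d * y)
     - chi i1 d * \sum_(i <- i0 :: i1 :: s) c i * chi i y.
  transitivity (\sum_(i <- i0 :: i1 :: s) (c i * (chi i d - chi i1 d)) * chi i y).
    by rewrite !big_cons subrr mulr0 mul0r add0r.
  rewrite mulr_sumr -sumrB; apply: eq_bigr => i _; rewrite chiM; ring.
by apply: vgeB => //; apply: vgeM0 => //; apply: chiY.
Qed.

(** * Galois action on valuations and the ramification index *)

Section GaloisValuation.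

Variables (K : fieldType) (v : K -> int) (L : splittingFieldType K).
Hypothesis complete_v : forall u, cauchy v u -> exists l, tends_to v u l.
Hypothesis galL : galois 1 {:L}.

Notation G := ('Gal({:L} / 1))%g.

(** [u \o g] is again an extension of [v], and over a complete base there is only one. *)
Lemma extends_gal (u : L -> rat) (g : gal_of {:L}) x :
  extends_valuation (in_alg L) v u -> x != 0 -> u (g x) = u x.
Proof.
move=> hu x0; apply: (@extension_unique _ _ _ complete_v (u \o g)) => //; split.
  split=> [y z y0 z0|y z c] /=.
    by rewrite rmorphM (valuationM (ev_valuation hu)) ?fmorph_eq0.
  have gE t : vge (u \o g) c t = vge u c (g t) by rewrite /vge fmorph_eq0.
  by rewrite !gE rmorphD; apply: (valuationD (ev_valuation hu)).
by move=> c c0 /=; rewrite rmorph_alg (ev_restrict hu).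
Qed.

(** Norms to [K] show that [u] takes values in (1/n)Z, n being the order of the Galois group. If m/n
    is the least positive value, Euclidean division makes every value a multiple of it; since [v]
    takes the value 1, m divides n, and e = n/m. *)
Lemma normalize_extension (u : L -> rat) :
  normalized_valuation v -> extends_valuation (in_alg L) v u ->
  exists (w : L -> int) (e : nat), [/\ (0 < e)%N, normalized_valuation w &
    forall x, x != 0 -> (w x)%:~R = e%:R * u x].
Proof.
move=> [vv [c1 c10 vc1]] hu; have uv := ev_valuation hu.
pose n := #|G|; have n0 : (0 < n)%N by rewrite cardG_gt0.
have int_val x : x != 0 -> exists z : int, z%:~R = n%:R * u x.
  move=> x0; have /vlineP[c hc] := mem_galNorm galL (memvf x).
  have [N0 uN] : galNorm 1 {:L} x != 0 /\ u (galNorm 1 {:L} x) = n%:R * u x.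
    rewrite /galNorm mulr_natl -sumr_const.
    elim/big_rec2: _ => [|g y1 y2 _ [y0 IH]]; first by rewrite oner_neq0 (val1 uv).
    have gx0 : g x != 0 by rewrite fmorph_eq0.
    by rewrite mulf_neq0 // (valuationM uv) // IH extends_gal.
  exists (v c); rewrite -uN hc -(ev_restrict hu) //.
  by apply: contra N0 => /eqP c0; rewrite hc c0 scale0r.
pose P m := (0 < m)%N && `[< exists2 x, x != 0 & n%:R * u x = m%:R >].
have exP : exists m, P m.
  exists n; rewrite /P n0; apply/asboolP; exists (in_alg L c1); first by rewrite fmorph_eq0.
  by rewrite (ev_restrict hu) // vc1 mulr1.
case: (ex_minnP exP) => m /andP[m0 /asboolP[x0 x00 ux0]] mmin.
have dvd_nat x j : x != 0 -> n%:R * u x = j%:R -> (m %| j)%N.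
  move=> xn0 ux; rewrite /dvdn; apply: contraT; rewrite -lt0n => jm.
  suff : (m <= j %% m)%N by rewrite leqNgt ltn_mod m0.
  apply: mmin; rewrite /P jm; apply/asboolP; exists (x * (x0 ^+ (j %/ m))^-1).
    by rewrite mulf_neq0 // invr_eq0 expf_neq0.
  have x0j : x0 ^+ (j %/ m) != 0 by rewrite expf_neq0.
  have -> : u (x * (x0 ^+ (j %/ m))^-1) = u x - u x0 *+ (j %/ m).
    have y0 : x * (x0 ^+ (j %/ m))^-1 != 0 by rewrite mulf_neq0 // invr_eq0.
    have := valuationM uv y0 x0j; rewrite mulfVK // (valX uv) // => ->.
    by rewrite addrK.
  rewrite mulrBr ux mulrnAr ux0 {1}(divn_eq j m) natrD natrM -[m%:R *+ _]mulr_natl; ring.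
have dvd_int x : x != 0 -> exists z : int, n%:R * u x = (z * m%:Z)%:~R.
  move=> xn0; have [z hz] := int_val x xn0.
  case: z hz => j hz.
    by have /dvdnP[d jE] := dvd_nat x j xn0 (esym hz); exists d%:Z; rewrite -hz jE PoszM.
  have xi0 : x^-1 != 0 by rewrite invr_eq0.
  have ui : u x^-1 = - u x.
    apply/eqP; rewrite -addr_eq0 -(valuationM uv) // mulVf // (val1 uv) //.
  have := dvd_nat x^-1 j.+1 xi0; rewrite ui mulrN -hz NegzE mulrNz opprK => /(_ erefl).
  by move=> /dvdnP[d jE]; exists (- d%:Z); rewrite jE PoszM mulNr mulrNz.
have /dvdnP[e ne] : (m %| n)%N.
  apply: (dvd_nat (in_alg L c1)); first by rewrite fmorph_eq0.
  by rewrite (ev_restrict hu) // vc1 mulr1.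
have e0 : (0 < e)%N by move: n0; rewrite ne muln_gt0 => /andP[].
have m0Q : m%:R != 0 :> rat by rewrite pnatr_eq0 -lt0n.
have /choice[w hw] x : exists z : int, x != 0 -> z%:~R = e%:R * u x.
  have [->|xn0] := eqVneq x 0; first by exists 0.
  have [z hz] := dvd_int x xn0; exists z => _; apply: (mulIf m0Q).
  by move: hz; rewrite ne natrM intrM => <-; ring.
exists w, e; split=> //; split.
  have e0Q : 0 < e%:R :> rat by rewrite ltr0n.
  have wE c x : vge w c x = vge u (c%:~R / e%:R) x.
    rewrite /vge; case: eqVneq => //= xn0.
    by rewrite -(ler_int rat) hw // ler_pdivrMr // mulrC.
  split=> [x y xn0 yn0|x y c].
    apply/(@intr_inj rat); rewrite intrD !hw ?mulf_neq0 // (valuationM uv) //; ring.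
  by rewrite !wE; apply: valuationD uv _ _ _.
exists x0 => //; apply/(@intr_inj rat); rewrite hw //; apply: (mulIf m0Q).
by rewrite mulr1z mul1r -[RHS]ux0 ne natrM; ring.
Qed.


Section Inertia.

Variables (w : L -> int) (e : nat) (M : {subfield L}).
Hypothesis hw : normalized_valuation w.
Hypothesis w_gal : forall (g : gal_of {:L}) x, x != 0 -> w (g x) = w x.
Hypothesis w_base : forall c : K, c != 0 -> w c%:A = e%:Z * v c.
(* [M] is unramified over [K]: [Gal(M/K)] acts faithfully on residues. *)
Hypothesis faithful : forall g : gal_of {:L},
  {in M, g =1 id} \/ exists c, [/\ c \in M, vge w 0 c, c - g c != 0 & w (c - g c) = 0].

(** On [K] all values of [w] are multiples of [e], so an element of [K] of valuation |H|, H =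
    Gal(L/M), suffices. It is the trace from M to K of y times the norm from L to M of a
    uniformizer: each conjugate of the norm has valuation |H|, and independence of residual
    characters gives an integral [y] in [M] for which the sum gains no further valuation. *)
Lemma ramification_index_dvd : (e %| #|'Gal({:L} / M)%g|)%N.
Proof.
have [wv [pi pi0 wpi]] := hw.
set H := 'Gal({:L} / M)%G.
have HG : H \subset G by apply: galS; apply: sub1v.
have HM (h : gal_of {:L}) y : h \in H -> y \in M -> h y = y.
  by move=> hH; apply: fixed_gal hH; apply: subvf.
(* For a coset C of H this is the conjugate by C of the norm of [pi] from L to M. On M the coset
   acts through any representative, [r C] below. *)
pose N (C : {set gal_of {:L}}) := \prod_(g in C) g pi.
have wN C : N C != 0 /\ w (N C) = #|C|%:Z.
  rewrite /N -sum1_card; elim/big_rec2: _ => [|g x y _ [y0 wy]].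
    by rewrite oner_neq0 (val1 wv).
  have gp0 : g pi != 0 by rewrite fmorph_eq0.
  by rewrite mulf_neq0 // (valuationM wv) // wy w_gal // wpi.
pose Y y := y \in M /\ vge w 0 y.
have Yg (g : gal_of {:L}) y : Y y -> vge w 0 (g y).
  by case=> _; rewrite /vge fmorph_eq0; case: eqVneq => //= y0; rewrite w_gal.
have gM (g1 g2 : gal_of {:L}) x : (g1 * g2)%g x = g2 (g1 x) by rewrite galM ?memvf.
have rep C : C \in rcosets H G -> C = (H :* repr C)%g.
  by move=> /rcosetsP[g gG ->]; apply/esym/rcoset_eqP; apply: mem_repr_rcoset.
have repH : repr H \in H by apply: mem_repr (group1 _).
pose r (C : {set gal_of {:L}}) : gal_of {:L} := repr C.
pose s := enum (rcosets H G :\ (H : {set _})).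
have [y Yy hy] : exists2 y, Y y & ~~ vge w (#|H|%:Z + 1)
    (\sum_(C <- (H : {set gal_of {:L}}) :: s) N C * r C y).
  apply: (@characters_independent L int w _ (fun C y => r C y) Y).
  - exact: wv.
  - by rewrite /Y mem1v vge_neq0 ?oner_neq0 // (val1 wv).
  - move=> x y [xM x0] [yM y0]; split; first exact: memvM.
    exact: vgeM0.
  - by move=> C; rewrite rmorph1.
  - by move=> C x y; rewrite rmorphM.
  - by move=> C y; apply: Yg.
  - move=> C; rewrite mem_enum !inE => /andP[CH CR].
    have [fixM|[c [cM c0 cn cw]]] := faithful (r C).
      have rC : r C \in H.
        rewrite gal_kHom ?subvf //; apply/kHomP_tmp; split=> //.
          by move=> x y _ _; rewrite rmorphM.
      by case/eqP: CH; rewrite (rep C CR) rcoset_id.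
    by exists c; rewrite (HM (r H)).
  - by have [N0 wNH] := wN H; rewrite vge_neq0 // wNH -ltNge ltrDl.
have sumE : \sum_(C <- (H : {set _}) :: s) N C * r C y =
    \sum_(C in rcosets H G) N C * r C y.
  rewrite big_cons /s big_enum /= [RHS](big_setD1 (H : {set _})) //.
  by apply/rcosetsP; exists 1%g; rewrite ?group1 // mulg1.
rewrite sumE {sumE} in hy; set T := \sum_(C in _) _ in hy.
have T0 : T != 0 by apply: contra hy => /eqP ->; apply: vge0.
have card_rc C : C \in rcosets H G -> #|C| = #|H|.
  by move=> /rcosetsP[g _ ->]; rewrite card_rcoset.
have Tge : vge w #|H|%:Z T.
  apply: vge_sum => // C CR; have [N0 wNC] := wN C.
  by rewrite mulrC; apply: vgeM0 => //; [apply: Yg | rewrite vge_neq0 // wNC card_rc].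
have wT : w T = #|H|%:Z.
  by apply/eqP; move: hy Tge; rewrite !vge_neq0 // -ltNge ltzD1 => l1 l2; rewrite eq_le l1 l2.
have T1 : T \in 1%VS.
  have /galois_fixedField <- := galL; apply/fixedFieldP; first exact: memvf.
  (* Right translation by [t] permutes the cosets and carries the term of C to that of C t; the two
     representatives differ by an element of H, which fixes [y]. *)
  move=> t tG; have tI : injective (fun C : {set gal_of {:L}} => (C :* t)%g).
    by apply: can_inj (fun C => (C :* t^-1)%g) _ => C; rewrite -rcosetM mulgV mulg1.
  rewrite rmorph_sum /= [RHS](reindex_inj tI) /=; apply: eq_big => [C|C CR].
    apply/idP/idP => /rcosetsP[g gG CE]; apply/rcosetsP.
      by exists (g * t)%g; rewrite ?groupM // CE rcosetM.
    by exists (g * t^-1)%g; rewrite ?groupM ?groupV // rcosetM -CE -rcosetM mulgV mulg1.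
  rewrite rmorphM /=; congr (_ * _).
    rewrite /N rmorph_prod /= [RHS](reindex_inj (mulIg t)) /=.
    by apply: eq_big => [g|g _]; rewrite ?mem_rcoset ?mulgK // gM.
  have CE := rep C CR.
  have : (repr (C :* t) \in C :* t)%g.
    apply: (@mem_repr _ _ (repr C * t)%g); rewrite mem_rcoset mulgK {2}CE.
    exact: rcoset_refl.
  rewrite {2}CE -rcosetM => /rcosetP[h' h'H rE].
  have -> : r (C :* t)%g y = (h' * (r C * t))%g y by rewrite /r rE.
  by rewrite -gM [RHS]gM (HM h') //; case: Yy.
have [c Tc] := vlineP _ _ T1; have c0 : c != 0 by apply: contra T0 => /eqP c0; rewrite Tc c0 scale0r.
have : (e%:Z %| #|H|%:Z)%Z by rewrite -wT Tc w_base //; apply: dvdz_mulr.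
by rewrite /dvdz.
Qed.

End Inertia.

End GaloisValuation.

(** * Ramification of the roots of D_a(X) - lambda *)

Lemma step_integral_le (c : nat -> rat) (C t : rat) (n : nat) :
  n%:R <= t -> (forall j, c j <= C) ->
  \sum_(1 <= j < n.+1) c j + (t - n%:R) * c n.+1 <= t * C.
Proof.
move=> nt hc; have sumc : \sum_(1 <= j < n.+1) c j <= n%:R * C.
  elim: n {nt} => [|n IH]; first by rewrite big_geq // mul0r.
  by rewrite big_nat_recr //= -natr1 mulrDl mul1r lerD.
have : (t - n%:R) * c n.+1 <= (t - n%:R) * C by rewrite ler_wpM2l // subr_ge0.
move: sumc; rewrite mulrBl; lra.
Qed.

(** The integrand |G_s|/|G_0| never exceeds 1. Hence phi(t) = u forces t >= u, and an element of G^u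
    lies in the lower group G_u. *)
Lemma herbrand_le (K : fieldType) (L : splittingFieldType K) (w : L -> int) (t : rat) :
  0 <= t -> herbrand w t <= t.
Proof.
move=> t0; rewrite /herbrand.
have G0_gt0 : 0 < #|lower_ramification w 0|%:R :> rat.
  rewrite ltr0n; apply/card_gt0P; exists 1%g; rewrite inE group1.
  by apply/asboolP => x _; rewrite gal_id eqxx.
rewrite ler_pdivrMr //.
apply: (@step_integral_le (fun j => #|lower_ramification w j%:R|%:R)) => [|j].
  by rewrite truncn_le.
rewrite ler_nat; apply/subset_leq_card/subsetP => g.
rewrite !inE => /andP[-> /asboolP hg]; apply/asboolP => x /hg /orP[->//|h].
by apply/orP; right; apply: le_trans h; rewrite lerD2r ler0n.
Qed.

(** The hypothesis on [g] applies to the unit [z * pi ^+ N], and by induction [g] moves [pi ^+ n] by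
    valuation at least T + n. Together these give valuation at least T to (g z - z) pi^N, whose
    valuation is N. *)
Lemma lower_ramification_bound (L : fieldType) (w : L -> int) (g : {rmorphism L -> L})
    (T : int) (N : nat) (z : L) :
  normalized_valuation w -> (forall x, x != 0 -> w (g x) = w x) ->
  (forall x, vge w 0 x -> vge w (T + 1) (g x - x)) ->
  z != 0 -> w z = - N%:Z -> g z - z != 0 -> w (g z - z) = 0 -> T <= N%:Z.
Proof.
move=> [wv [pi pi0 wpi]] wg hT z0 wz d0 wd.
have wpiN n : w (pi ^+ n) = n%:Z by rewrite (valX wv) // wpi natz.
have piN0 n : pi ^+ n != 0 by rewrite expf_neq0.
have hpi n : vge w (T + n%:Z) (g (pi ^+ n) - pi ^+ n).
  elim: n => [|n IH]; first by rewrite expr0 rmorph1 subrr vge0.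
  have -> : g (pi ^+ n.+1) - pi ^+ n.+1 =
      (g pi - pi) * g (pi ^+ n) + (g (pi ^+ n) - pi ^+ n) * pi.
    by rewrite exprSr rmorphM; ring.
  have -> : T + n.+1%:Z = (T + 1) + n%:Z by lia.
  apply: valuationD => //.
    apply: vgeM => //; first by apply: hT; rewrite vge_neq0 // wpi.
    by rewrite vge_neq0 ?fmorph_eq0 // wg // wpiN.
  have -> : (T + 1) + n%:Z = (T + n%:Z) + 1 by lia.
  by apply: vgeM => //; rewrite vge_neq0 // wpi.
have hzy : vge w (T + 1) (g (z * pi ^+ N) - z * pi ^+ N).
  by apply: hT; rewrite vge_neq0 ?mulf_neq0 // (valuationM wv) // wz wpiN addNr.
have : vge w T ((g z - z) * pi ^+ N).
  have -> : (g z - z) * pi ^+ N =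
     (g (z * pi ^+ N) - z * pi ^+ N) - g z * (g (pi ^+ N) - pi ^+ N).
    by rewrite rmorphM; ring.
  apply: vgeB => //; first by apply: vgeW hzy; lia.
  have -> : T = - N%:Z + (T + N%:Z) by lia.
  by apply: vgeM => //; rewrite vge_neq0 ?fmorph_eq0 // wg // wz.
by rewrite vge_neq0 ?mulf_neq0 // (valuationM wv) // wd wpiN add0r.
Qed.

Lemma fixed_generators (K : fieldType) (L : splittingFieldType K) (s : seq L)
    (g : gal_of {:L}) :
  (forall x, x \in s -> g x = x) -> {in <<1 & s>>%VS, g =1 id}.
Proof.
move=> gs; apply/fixedSpacesP.
apply/(@Fadjoin_seqP K L 1%AS s (fixedSpace_aspace (gal_repr g))); split.
  exact: sub1v.
by move=> x /gs gx; apply/fixedSpaceP.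
Qed.

Section RootField.

Variables (Fq : finFieldType) (K : fieldType) (cK : {rmorphism Fq -> K}).
Variables (v : K -> int) (k : finFieldType) (red : K -> k).
Hypothesis hK : local_field v red.
Variables (Ks : fieldType) (iK : {rmorphism K -> Ks}).
Hypothesis hKs : separable_closure iK.
Variable vs : Ks -> rat.
Hypothesis hvs : extends_valuation iK v vs.
Variable f : {poly K}.
Hypothesis hf : unit_skew_poly v f.

Notation q := #|Fq|.
Notation ev := (skew_eval Fq iK f).

Lemma separable_skew_poly lam : separable_poly (skew_poly Fq f - lam%:P).
Proof.
rewrite unlock derivB derivC subr0 (deriv_skew_poly cK) -(alg_polyC f`_0).
by rewrite coprimepZr ?coprimep1 // (usp_const_neq0 hf).
Qed.

Lemma skew_solution lam : exists z, ev z = iK lam.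
Proof.
have f0 := usp_neq0 hf.
have [z] : exists z, root (map_poly iK (skew_poly Fq f - lam%:P)) z.
  apply: (sc_closed hKs); first by rewrite separable_map separable_skew_poly.
  rewrite size_map_poly size_polyDl size_skew_poly // ?size_polyN.
    by rewrite ltnS expn_gt0 (ltnW (finNzRing_gt1 Fq)).
  by apply: leq_ltn_trans (size_polyC_leq1 _) _; rewrite ltnS expn_gt0 (ltnW (finNzRing_gt1 Fq)).
rewrite rootE rmorphB /= map_polyC hornerD hornerN hornerC horner_skew_poly subr_eq0.
by move/eqP; exists z.
Qed.

(** As [z] is integral, inertia makes [sigma z - z] zero or of positive valuation; as a torsion
    point it is zero or a unit. The case [lam = 0] covers D[a], the other cases the integral
    generators of the lattice. *)
Lemma inertia_fixes_integral sigma lam z :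
  inertia iK vs sigma -> ev z = iK lam -> vge v 0 lam -> sigma z = z.
Proof.
move=> [[_ sK] hs] ez l0; apply/eqP; rewrite -subr_eq0.
have td : ev (sigma z - z) = 0.
  by rewrite (skew_evalB cK) -(skew_eval_morph Fq f z sK) ez sK subrr.
apply: contraT => d0; have := skew_root_unit hvs hf d0 td.
have zi : vge vs 0 z.
  by apply: (skew_eval_integral hvs hf (Fq := Fq)); rewrite ez (extends_vge 0 _ hvs).
by case: (hs z zi) => [zz|/lt_eqF/eqP]; [rewrite zz subrr eqxx in d0 | move=> h h'; case: h].
Qed.

Lemma upper_inertia_fixes_pole sigma (m : int) lam z :
  upper_inertia iK vs m%:~R sigma -> ev z = iK lam -> ~~ vge v 0 lam ->
  - v lam + 1 <= m -> sigma z = z.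
Proof.
move=> [[[_ sK] _] ram] ez lam_pole hm.
have [vv compl _] := hK.
have f0 := usp_neq0 hf; have q0 : (0 < q)%N := ltnW (finNzRing_gt1 Fq).
have l0 : lam != 0 by apply: contra lam_pole => /eqP ->; apply: vge0.
have vl : v lam < 0 by rewrite ltNge -vge_neq0.
have z0 : z != 0.
  by apply: contra l0 => /eqP zz; rewrite -(fmorph_eq0 iK) -ez zz (skew_evalr0 cK).
pose d := (size f).-1.
have vz : (q ^ d)%:R * vs z = (v lam)%:~R.
  have vz : vs z < 0.
    rewrite ltNge -vge_neq0 //; apply: contra lam_pole => hz.
    rewrite -(extends_vge 0 lam hvs) -ez (skew_evalE Fq iK z (leqnn _)).
    apply: vge_sum; first exact: (ev_valuation hvs).
    move=> i _; apply: vgeM0; first exact: (ev_valuation hvs).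
      exact: (usp_coef hvs hf).
    by apply: vge0X => //; apply: (ev_valuation hvs).
  by have [_ <-] := skew_eval_pole Fq hvs hf z0 vz; rewrite ez (ev_restrict hvs).
pose g := skew_poly Fq f - lam%:P.
have gE x : root (map_poly iK g) x = (ev x == iK lam).
  by rewrite rootE rmorphB /= map_polyC hornerD hornerN hornerC horner_skew_poly subr_eq0.
have szg : size g = (q ^ d).+1.
  rewrite size_polyDl size_skew_poly // size_polyN.
  by apply: leq_ltn_trans (size_polyC_leq1 _) _; rewrite ltnS expn_gt0 q0.
have sepg : separable_poly g by apply: separable_skew_poly.
have [s gs] : exists s, map_poly iK g %= \prod_(x <- s) ('X - x%:P).
  by apply: separable_splits (sc_closed hKs) _; rewrite separable_map.
have sz_s : size s = (q ^ d)%N.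
  by apply: succn_inj; rewrite -szg -(size_map_poly iK) (eqp_size gs) size_prod_XsubC.
have memS x : (x \in s) = (ev x == iK lam) by rewrite -gE (eqp_root gs) root_prod_XsubC.
have [L [i [s1 [galL iE is1 gen]]]] := splitting_extension sepg gs.
pose u x := vs (i x).
have hu : extends_valuation (in_alg L) v u.
  split; last by move=> c c0; rewrite /u /= iE (ev_restrict hvs).
  have uE c x : vge u c x = vge vs c (i x) by rewrite /vge fmorph_eq0.
  split=> [x y x0 y0|x y c].
    by rewrite /u rmorphM (valuationM (ev_valuation hvs)) ?fmorph_eq0.
  by rewrite !uE rmorphD; apply: (valuationD (ev_valuation hvs)).
have [w [e [e0 nw wu]]] := normalize_extension compl galL vv hu.
have e0Q : 0 < e%:R :> rat by rewrite ltr0n.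
have wgal (g' : gal_of {:L}) x : x != 0 -> w (g' x) = w x.
  move=> x0; apply/(@intr_inj rat); rewrite !wu ?fmorph_eq0 //.
  by rewrite (extends_gal compl).
have w_unit x : x != 0 -> u x = 0 -> w x = 0.
  by move=> x0 ux; apply/(@intr_inj rat); rewrite wu // ux mulr0.
have evi x : i (skew_eval Fq (in_alg L) f x) = ev (i x).
  exact: (skew_eval_morph Fq f x (i1 := in_alg L) (s := i) iE).
have evg (g' : gal_of {:L}) x :
    g' (skew_eval Fq (in_alg L) f x) = skew_eval Fq (in_alg L) f (g' x).
  by apply: (skew_eval_morph Fq f x (i1 := in_alg L) (s := g')) => a; apply: rmorph_alg.
have mem1 x : (x \in s1) = (skew_eval Fq (in_alg L) f x == in_alg L lam).
  rewrite -(mem_map (fmorph_inj i)) is1 memS -(iE lam).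
  by rewrite -evi (inj_eq (fmorph_inj i)).
have [z1 z1s iz1] : exists2 z1, z1 \in s1 & i z1 = z.
  have : z \in s by rewrite memS ez.
  by rewrite -is1 => /mapP[z1 z1s ->]; exists z1.
pose T c := skew_eval Fq (in_alg L) f c = 0.
have TB c c' : T c -> T c' -> T (c - c').
  by rewrite /T (skew_evalB cK) => -> ->; rewrite subrr.
have Tg (g' : gal_of {:L}) c : T c -> T (g' c).
  by move=> Tc; rewrite /T -evg Tc rmorph0.
have T_s1 x y : x \in s1 -> y \in s1 -> T (x - y).
  by rewrite !mem1 /T (skew_evalB cK) => /eqP -> /eqP ->; rewrite subrr.
have T_unit c : T c -> c != 0 -> w c = 0.
  by move=> Tc c0; apply: w_unit => //; exact: (skew_root_unit (Fq := Fq) hu hf c0 Tc).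
have T_int c : T c -> vge w 0 c.
  by move=> Tc; have [->|c0] := eqVneq c 0; [apply: vge0 | rewrite vge_neq0 // T_unit].
(* The roots form the coset z1 + D[a], so [ds] lists D[a] and [M] is K(D[a]). *)
pose ds := [seq x - z1 | x <- s1].
have Tds c : c \in ds -> T c by case/mapP=> x xs ->; apply: T_s1.
pose M := <<1 & ds>>%AS.
(* If [g'] moves a torsion point [c], then [c - g' c] is a nonzero torsion point, hence a unit. *)
have faithful (g' : gal_of {:L}) : {in M, g' =1 id} \/
    exists c, [/\ c \in M, vge w 0 c, c - g' c != 0 & w (c - g' c) = 0].
  have [/allP fix_ds|/allPn[c cds gc]] := boolP (all (fun c => g' c == c) ds).
    by left; apply: fixed_generators => x /fix_ds/eqP.
  have c0 : c - g' c != 0 by rewrite subr_eq0 eq_sym.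
  have Tc := Tds c cds; right; exists c; split=> //; first exact: seqv_sub_adjoin.
    exact: T_int.
  by apply: T_unit => //; apply: TB => //; apply: Tg.
have w_base (c : K) : c != 0 -> w c%:A = e%:Z * v c.
  move=> c0; apply/(@intr_inj rat); rewrite wu ?(fmorph_eq0 (in_alg L)) //.
  by rewrite (ev_restrict hu) // intrM.
have eH := ramification_index_dvd galL nw wgal w_base faithful.
(* An element of Gal(L/M) fixes every [y - z1], so the image of [z1], one of the q^d roots,
   determines it. *)
have cardH : (#|'Gal({:L} / M)%g| <= q ^ d)%N.
  rewrite -sz_s -is1 size_map cardE -(size_map (fun h : gal_of {:L} => h z1)).
  apply: uniq_leq_size.
    rewrite map_inj_in_uniq ?enum_uniq // => h h'; rewrite !mem_enum => hH h'H hz.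
    apply/eqP/gal_eqP => x _.
    have fixH (h0 : gal_of {:L}) y : h0 \in 'Gal({:L} / M)%g -> y \in s1 -> h0 y = y - z1 + h0 z1.
      move=> h0H ys; rewrite -{1}(subrK z1 y) rmorphD; congr (_ + _).
      apply: (fixed_gal (subvf M) h0H); apply: seqv_sub_adjoin.
      by apply/mapP; exists y.
    have hh : {in <<1 & s1>>%VS, (h * h'^-1)%g =1 id}.
      apply: fixed_generators => y ys; rewrite galM ?memvf // (fixH h) // hz -(fixH h') //.
      by rewrite -galM ?memvf // mulgV gal_id.
    have := hh x; rewrite gen memvf => /(_ isT) /(congr1 h').
    by rewrite -galM ?memvf // mulgKV.
  move=> _ /mapP[h hH ->]; rewrite mem1.
  by move: z1s; rewrite -evg mem1 => /eqP ->; rewrite rmorph_alg.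
have eq_d : (e <= q ^ d)%N by apply: leq_trans cardH; apply: dvdn_leq eH; apply: cardG_gt0.
have [|g' sg [t [t0 tm gt]]] := ram L i w galL iE nw; first by exists e.
have mt : m%:~R <= t by rewrite -tm herbrand_le.
rewrite -iz1 sg; congr (i _); apply/eqP; rewrite -subr_eq0; apply: contraT => dz0.
have z10 : z1 != 0 by rewrite -(fmorph_eq0 i) iz1.
have vQ : 0 < (q ^ d)%:R :> rat by rewrite ltr0n expn_gt0 q0.
have wz1 : (w z1)%:~R * (q ^ d)%:R = e%:R * (v lam)%:~R :> rat.
  by rewrite wu // /u iz1 -vz; ring.
have wz1_neg : w z1 <= 0.
  rewrite -(ler_int rat) -(pmulr_lle0 _ vQ) wz1 pmulr_rle0 // lerz0; exact: ltW.
have bound : v lam <= w z1.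
  rewrite -(ler_int rat) -(ler_pM2r vQ) wz1 mulrC ler_wnM2r //.
    by rewrite lerz0 ltW.
  by rewrite ler_nat.
have gz1s : g' z1 \in s1.
  by move: z1s; rewrite !mem1 -evg => /eqP ->; rewrite rmorph_alg.
have := @lower_ramification_bound L w g' m `|w z1|%N z1 nw (wgal g').
suff hT x : vge w 0 x -> vge w (m + 1) (g' x - x).
  have wzN : w z1 = - `|w z1|%N%:Z by rewrite lez0_abs // opprK.
  (* This yields [m <= - w z1 <= - v lam], which the [+ 1] in [hm] contradicts. *)
  move=> /(_ hT z10 wzN dz0 (T_unit _ (T_s1 _ _ gz1s z1s) dz0)).
  rewrite lez0_abs // => mN; have := le_trans hm (le_trans mN _).
  by rewrite -(lerN2 _ _) in bound => /(_ _ bound); rewrite gerDl ler10.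
move: gt; rewrite inE => /andP[_ /asboolP h] /h /orP[/eqP->|hx].
  by rewrite subrr vge0.
have [->|x0] := eqVneq (g' x - x) 0; first exact: vge0.
rewrite vge_neq0 // -(ler_int rat); apply: le_trans hx.
by rewrite intrD lerD2r.
Qed.

End RootField.

(** * The monodromy representation *)

Section InertiaValuation.

Variables (K : fieldType) (v : K -> int) (Ks : fieldType) (iK : {rmorphism K -> Ks}).
Variable vs : Ks -> rat.
Hypothesis hv : normalized_valuation v.
Hypothesis hvs : extends_valuation iK v vs.

Lemma nval_surjective (z : int) : exists2 c, c != 0 & v c = z.
Proof.
have [vv [pi pi0 vpi]] := hv; have vX n : v (pi ^+ n) = n%:Z by rewrite (valX vv) // vpi natz.
case: z => n; first by exists (pi ^+ n); rewrite ?expf_neq0.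
have pn : pi ^+ n.+1 != 0 by rewrite expf_neq0.
exists (pi ^+ n.+1)^-1; first by rewrite invr_eq0.
have := valuationM vv pn (invr_neq0 pn); rewrite mulfV // (val1 vv) vX NegzE.
by move/esym/eqP; rewrite addrC addr_eq0 => /eqP.
Qed.

(** For a unit [y], the difference [sigma y - y] is too small to affect the valuation. Any [x]
    becomes a unit after raising it to the denominator of [vs x] and multiplying by an element of
    [K]. The invariance lets [sigma] pass through the limit defining [e]. *)
Lemma inertia_val sigma x : inertia iK vs sigma -> x != 0 -> vs (sigma x) = vs x.
Proof.
move=> [[_ sK] hs] x0; have uv := ev_valuation hvs.
have unit_val y : y != 0 -> vs y = 0 -> vs (sigma y) = 0.
  move=> y0 vy; have [-> //|d0] := eqVneq (sigma y) y.
  have [d1|d1] : sigma y = y \/ 0 < vs (sigma y - y) by apply: hs; rewrite vge_neq0 // vy.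
    by rewrite d1 eqxx in d0.
  have [_] : y + (sigma y - y) != 0 /\ vs (y + (sigma y - y)) = vs y.
    by apply: val_dominant uv y0 _ (vge_val _ _); rewrite vy.
  by rewrite addrC subrK vy.
have [c c0 vc] := nval_surjective (- numq (vs x)).
pose b := `|denq (vs x)|%N.
have bE : b%:R * vs x = (numq (vs x))%:~R.
  rewrite [in RHS]numqE mulrC; congr (_ * _).
  by rewrite /b -[LHS]/((Posz `|denq (vs x)|%N)%:~R) absz_denq.
have b0 : b%:R != 0 :> rat by rewrite pnatr_eq0 /b absz_eq0 denq_neq0.
have ic0 : iK c != 0 by rewrite fmorph_eq0.
have val_y t : t != 0 -> vs (t ^+ b * iK c) = b%:R * vs t - b%:R * vs x.
  move=> t0; rewrite (valuationM uv) ?expf_neq0 // (valX uv) // (ev_restrict hvs) // vc.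
  by rewrite mulrNz bE mulr_natl.
have := unit_val (x ^+ b * iK c); rewrite mulf_neq0 ?expf_neq0 // val_y // subrr.
move=> /(_ isT erefl); rewrite rmorphM rmorphXn sK val_y ?fmorph_eq0 //.
by move/eqP; rewrite subr_eq0 => /eqP/(mulfI b0).
Qed.

Lemma inertia_vge sigma c x : inertia iK vs sigma -> vge vs c (sigma x) = vge vs c x.
Proof.
move=> hs; have [->|x0] := eqVneq x 0; first by rewrite rmorph0.
by rewrite !vge_neq0 ?fmorph_eq0 // inertia_val.
Qed.

End InertiaValuation.

(* [f x = c x + O(x^2)] as [x] tends to [0]. *)
Definition linear_part (K : fieldType) (v : K -> rat) (f : K -> K) (c : K) : Prop :=
  exists C : rat, forall d x, C <= d -> vge v d x -> vge v (2%:R * d - C) (f x - c * x).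

(** * Linear terms of analytic maps at the origin *)

Section LinearPart.

Variables (K : fieldType) (v : K -> rat).
Hypothesis hv : valuation v.

(** At a small [x] the product (c - c') x is a difference of two O(x^2) errors, so c - c' has
    arbitrarily large valuation. *)
Lemma linear_part_unique f c c' (small : nat -> K) :
  (forall n, small n != 0 /\ v (small n) = n%:R) ->
  linear_part v f c -> linear_part v f c' -> c = c'.
Proof.
move=> hsmall [C hC] [C' hC']; apply/eqP; rewrite -subr_eq0; apply/eqP/(vge_all_eq0 (v := v)) => r.
have [n hn] := arch_rat (`|C| + `|C'| + `|r|); have [x0 vx] := hsmall n.
have := ler_norm C; have := ler_norm C'; have := ler_norm r.
have := normr_ge0 C; have := normr_ge0 C'; have := normr_ge0 r => ? ? ? ? ? ?.
have xn : vge v n%:R (small n) by rewrite vge_neq0 // vx.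
have : vge v (r + n%:R) ((c - c') * small n).
  have -> : (c - c') * small n =
     (f (small n) - c' * small n) - (f (small n) - c * small n) by ring.
  apply: vgeB => //.
    by apply: vgeW (hC' n%:R _ _ xn); lra.
  by apply: vgeW (hC n%:R _ _ xn); lra.
have [->|d0] := eqVneq (c - c') 0; first by rewrite vge0.
by rewrite !vge_neq0 ?mulf_neq0 // (valuationM hv) // vx lerD2r.
Qed.

Lemma linear_part_comp f g c c' :
  linear_part v f c -> linear_part v g c' -> linear_part v (f \o g) (c * c').
Proof.
move=> [C hC] [C' hC'].
have := ler_norm C; have := ler_norm C'; have := ler_norm (- v c); have := ler_norm (- v c').
have := normr_ge0 C; have := normr_ge0 C'; have := normr_ge0 (- v c); have := normr_ge0 (- v c').
set a1 := `|C|; set a2 := `|C'|; set a3 := `|- v c|; set a4 := `|- v c'| => ? ? ? ? ? ? ? ?.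
exists (3%:R * (a1 + a2 + a3 + a4)) => d x hd dx /=.
have cx : vge v (d - a4) (c' * x).
  rewrite addrC; apply: vgeM => //; have [->|c0] := eqVneq c' 0; first exact: vge0.
  by rewrite vge_neq0 //; lra.
have hg : vge v (2%:R * d - C') (g x - c' * x) by apply: hC' => //; lra.
have gx : vge v (d - a2 - a4) (g x).
  rewrite -[g x](subrK (c' * x)); apply: valuationD => //; first by apply: vgeW hg; lra.
  by apply: vgeW cx; lra.
have -> : f (g x) - c * c' * x = (f (g x) - c * g x) + c * (g x - c' * x) by ring.
apply: valuationD => //; first by apply: vgeW (hC _ _ _ gx); lra.
apply: (@vgeW _ _ _ _ (v c + (2%:R * d - C'))); first by lra.
by apply: vgeM => //; apply: vge_val.
Qed.

End LinearPart.

Lemma coef_bounded (K : fieldType) (G : realDomainType) (v : K -> G) (s : nat -> K) N :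
  exists2 B : G, B <= 0 & forall i, (i < N)%N -> vge v B (s i).
Proof.
elim: N => [|N [B B0 hB]]; first by exists 0.
exists (Order.min B (v (s N))); first by rewrite ge_min B0.
move=> i; rewrite ltnS leq_eqVlt => /orP[/eqP ->|/hB].
  by apply: vgeW (vge_val _ _); rewrite ge_min lexx orbT.
by apply: vgeW; rewrite ge_min lexx.
Qed.

Lemma vgeX_sq (K : fieldType) (v : K -> rat) (d : rat) (x : K) n :
  valuation v -> 0 <= d -> (1 < n)%N -> vge v d x -> vge v (2%:R * d) (x ^+ n).
Proof.
move=> hv d0 n1 dx; apply: vgeW (vgeX hv n dx).
by rewrite mulr_natl ler_wpMn2l.
Qed.

Lemma skew_eval_linear_part (Fq : finFieldType) (K Ks : fieldType)
    (iK : {rmorphism K -> Ks}) (vs : Ks -> rat) (f : {poly K}) :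
  valuation vs -> linear_part vs (skew_eval Fq iK f) (iK f`_0).
Proof.
move=> hv; have [B B0 hB] := coef_bounded vs (fun i => iK f`_i) (size f).+1.
exists (- B) => d x hd dx; rewrite opprK.
rewrite (skew_evalE Fq iK x (leqnSn _)) big_ord_recl expn0 expr1 addrAC subrr add0r.
apply: vge_sum => // i _; rewrite [X in vge _ X]addrC; apply: vgeM => //.
  exact: hB (ltn_ord (lift ord0 i)).
apply: vgeX_sq => //; first by lra.
by rewrite /bump -[1%N](expn0 #|Fq|) ltn_exp2l ?finNzRing_gt1.
Qed.

(** Convergence at 1 bounds all coefficients, so the part of degree at least 2 is O(x^2) near 0;
    [e 0 = 0] removes the constant term. *)
Lemma series_linear_part (K Ks : fieldType) (iK : {rmorphism K -> Ks})
    (vs : Ks -> rat) (s : nat -> K) (e : Ks -> Ks) :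
  valuation vs -> e 0 = 0 ->
  (forall x, tends_to vs (fun N => \sum_(i < N) iK (s i) * x ^+ i) (e x)) ->
  linear_part vs e (iK (s 1%N)).
Proof.
move=> hv e0 hs; have [N hN] := hs 1 0.
have [B B0 hB] := coef_bounded vs (fun i => iK (s i)) N.
have {}hB i : vge vs B (iK (s i)).
  have [iN|Ni] := ltnP i N; first exact: hB.
  apply: vgeW B0 _; have -> : iK (s i) = (\sum_(j < i.+1) iK (s j) * 1 ^+ j - e 1)
      - (\sum_(j < i) iK (s j) * 1 ^+ j - e 1).
    by rewrite big_ord_recr /= expr1n mulr1; ring.
  by apply: vgeB => //; apply: hN => //; apply: leqW.
have s0 : iK (s 0%N) = 0.
  apply: (vge_all_eq0 (v := vs)) => c; have [M hM] := hs 0 c.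
  have := hM M.+1 (leqnSn M); rewrite e0 subr0 big_ord_recl expr0 mulr1 big1 ?addr0 // => i _.
  by rewrite expr0n mulr0.
exists (- B) => d x hd dx; rewrite opprK.
have lim : tends_to vs (fun N => \sum_(i < N) iK (s i) * x ^+ i - iK (s 1%N) * x)
    (e x - iK (s 1%N) * x).
  move=> c; have [M hM] := hs x c; exists M => n Mn.
  by rewrite opprB addrA subrK; apply: hM.
apply: (tends_to_vge hv lim (N := 2)) => -[|[|n]] // _.
rewrite !big_ord_recl expr0 mulr1 s0 add0r expr1 addrAC subrr add0r.
apply: vge_sum => // i _; rewrite [X in vge _ X]addrC; apply: vgeM => //.
by apply: vgeX_sq => //; lra.
Qed.

(** [has_rank] supplies a degree existentially, once for a module over O_K and once for its
    reduction; uniqueness identifies the two. *)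
Lemma degree_unique (Fq : finFieldType) (A : comNzRingType) (a : A) d d' :
  has_degree Fq a d -> has_degree Fq a d' -> d = d'.
Proof.
move=> h h'; apply/eqP; rewrite eqn_leq.
suff le d1 d2 : has_degree Fq a d1 -> has_degree Fq a d2 -> (d1 <= d2)%N by rewrite !le.
move=> {d d' h h'} [s [us ss hs]] [s' [_ ss' hs']].
rewrite -(leq_exp2l _ _ (finNzRing_gt1 Fq)) -ss -ss'.
have /choice[f hf] x : exists y, y \in s' /\ exists b, x - y = a * b.
  by have [y [hy _]] := hs' x; exists y.
rewrite -(size_map f); apply: uniq_leq_size => [|_ /mapP[x _ ->]]; last by case: (hf x).
rewrite map_inj_in_uniq // => x y xs ys fxy.
have [t [_ ht]] := hs x; rewrite -(ht x); last by split=> //; exists 0; rewrite subrr mulr0.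
apply: ht; split=> //; have [_ [b hb]] := hf x; have [_ [c hc]] := hf y.
exists (b - c); rewrite mulrBr -hb -hc fxy; ring.
Qed.

(** Equality of the ranks of D and of its reduction gives D_a and its reduction the same size, so
    the leading coefficient survives in the residue field. *)
Lemma drinfeld_unit_skew_poly (Fq : finFieldType)
    (F : fieldExtType {fraction {poly Fq}}) (A : comNzRingType) (jA : {rmorphism A -> F})
    (K : fieldType) (cK : {rmorphism Fq -> K}) (v : K -> int) (k : finFieldType)
    (red : K -> k) (D : A -> {poly K}) (a : A) :
  residue_map v red -> drinfeld_module_OK jA cK v red D -> a != 0 ->
  vge v 0 (D a)`_0 -> ~~ vge v 1 (D a)`_0 -> unit_skew_poly v (D a).
Proof.
move=> hred hD a0 D0 D1; have int_a i := dmo_integral hD a i.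
have unitP x : vge v 0 x -> ~~ vge v 1 x -> x != 0 /\ v x = 0.
  move=> x0 x1; have xn0 : x != 0 by apply: contra x1 => /eqP ->; apply: vge0.
  move: x0 x1; rewrite !vge_neq0 // -ltNge => h1 h2; split=> //; apply/eqP.
  by rewrite eq_le h1 andbT -ltzD1.
have [c0 vc0] := unitP _ D0 D1; split=> //.
have [r [[r0 hr] [_ hr']]] := dmo_same_rank hD.
have [d hd sd] := hr a a0; have [d' hd' sd'] := hr' a a0.
rewrite (degree_unique hd' hd) -sd in sd'.
have red0 : red 0 = 0 by apply/eqP; rewrite (red_eq0 hred) vge0.
have Da0 : D a != 0 by rewrite -size_poly_gt0 sd.
have : lead_coef (map_poly red (D a)) != 0.
  by rewrite lead_coef_eq0 -size_poly_gt0 sd' size_poly_gt0.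
rewrite /lead_coef sd' coef_map_id0 // (red_eq0 hred) ?int_a // => h.
by have [] := unitP _ (int_a _) h.
Qed.

Theorem theorem4p7
  (Fq : finFieldType)
  (K : fieldType) (cK : {rmorphism Fq -> K})
  (v : K -> int) (k : finFieldType) (red : K -> k)
  (hK : local_field v red)
  (Ks : fieldType) (iK : {rmorphism K -> Ks}) (hKs : separable_closure iK)
  (vs : Ks -> rat) (hvs : extends_valuation iK v vs)
  (F : fieldExtType {fraction {poly Fq}})
  (oo : F -> int) (hoo : normalized_valuation oo)
  (A : comNzRingType) (jA : {rmorphism A -> F}) (hA : coordinate_ring oo jA)
  (E : A -> {poly K}) (hE : drinfeld_module jA cK E)
  (hchar : finite_residual_characteristic v E)
  (D : A -> {poly K}) (Lam : Ks -> Prop) (e : Ks -> Ks)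
  (hunif : tate_uniformization jA cK v red iK vs E D Lam e)
  (hLam : defined_over_base iK Lam) :
  (exists2 m : int, 0 <= m &
     forall sigma : {rmorphism Ks -> Ks},
       upper_inertia iK vs m%:~R sigma -> rho_trivial jA v iK E sigma) /\
  (forall (n : nat) (lam : 'I_n -> K),
     generated_by Fq iK D Lam lam ->
     forall sigma : {rmorphism Ks -> Ks},
       upper_inertia iK vs
         (\big[Num.max/0]_(i < n) height v (lam i) + 1)%:~R sigma ->
       rho_trivial jA v iK E sigma).
Proof.
suff explicit (n : nat) (lam : 'I_n -> K) : generated_by Fq iK D Lam lam ->
    forall sigma : {rmorphism Ks -> Ks},
    upper_inertia iK vs (\big[Num.max/0]_(i < n) height v (lam i) + 1)%:~R sigma ->
    rho_trivial jA v iK E sigma.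
  (* The generators supplied by projectivity lie in [K], so the first claim is an instance of the
     explicit one. *)
  split=> //; have [n [g [h [gL _ _ hg]]]] := pl_projective (tu_lattice hunif).
  have /choice[lam hlam] (i : 'I_n) : exists y, iK y = g i by apply: hLam.
  exists (\big[Num.max/0]_(i < n) height v (lam i) + 1).
    by rewrite addr_ge0 // bigmax_ge_id.
  apply: explicit; split=> [i|x Lx]; first by rewrite hlam.
  exists (fun i => h i x); rewrite {1}(hg x Lx); apply: eq_bigr => i _; by rewrite hlam.
move=> [lamL lam_gen] sigma hsig T hT N x adm xinv.
have [[s s1 hser] eD elin eonto eker] := tu_map hunif.
have hD := tu_good hunif; have hDm := dmo_module hD.
have uv := ev_valuation hvs; have hv := lf_valuation hK.
have hs := proj1 hsig; have sK := proj2 (proj1 hs).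
have e0 : e 0 = 0 by apply: (addrI (e 0)); rewrite -eD !addr0.
(* Admissibility and [hchar] concern the characteristic of E, the valuations of torsion points that
   of D. When the linear terms of e D_a = E_a e are compared, the nonzero factor [s 1] cancels. *)
have D0E a : (D a)`_0 = (E a)`_0.
  have /choice[small hsmall] (n0 : nat) : exists c, c != 0 /\ vs c = n0%:R.
    have [c c0 vc] := nval_surjective hv n0%:Z.
    by exists (iK c); rewrite fmorph_eq0 (ev_restrict hvs) // vc.
  have le := series_linear_part uv e0 hser.
  have l1 := linear_part_comp uv le (skew_eval_linear_part Fq iK (D a) uv).
  have l2 := linear_part_comp uv (skew_eval_linear_part Fq iK (E a) uv) le.
  have ext : e \o skew_eval Fq iK (D a) = skew_eval Fq iK (E a) \o e.
    by apply/funext => y; apply: elin.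
  rewrite ext in l1; have := linear_part_unique uv hsmall l1 l2.
  by rewrite mulrC => /mulIf/(fmorph_inj iK); apply; rewrite fmorph_eq0.
have [a aN a_unit] : exists2 a, a \in N & ~~ vge v 1 (E a)`_0.
  apply: contrapT => h; case: adm => _; apply => a aN.
  rewrite /residual_characteristic unfold_in; apply: contrapT => /negP h'.
  by apply: h; exists a.
have a0 : a != 0.
  have E0 : E 0 = 0 by apply: (addrI (E 0)); rewrite -(dm_D hE) !addr0.
  by apply: contra a_unit => /eqP ->; rewrite E0 coef0 vge0.
have usp : unit_skew_poly v (D a).
  by apply: (drinfeld_unit_skew_poly (lf_residue hK) hD a0); rewrite D0E //; apply: hchar.
have Ey : act Fq iK E a (T N x) = 0.
  have [b hb] := xinv a aN.
  rewrite -(tm_linear hT a adm xinv) mulrC -hb; exact: (tm_vanish hT b adm).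
have [z ez] := eonto (T N x).
(* The series of [e] has coefficients in [K] and [sigma] preserves [vs], so at a fixed [z] the
   partial sums are fixed and so is their limit. *)
suff sz : sigma z = z.
  rewrite /rho -ez; apply: (tends_to_unique uv _ (hser z)).
  move=> c; have [M hM] := hser z c; exists M => n0 Mn0.
  have := hM n0 Mn0; rewrite -(inertia_vge hv hvs c _ hs) rmorphB rmorph_sum.
  by under eq_bigr => i _ do rewrite rmorphM rmorphXn sK sz.
have [b Lz] : exists b : 'I_n -> A, act Fq iK D a z = \sum_i act Fq iK D (b i) (iK (lam i)).
  by apply: lam_gen; apply/eker; rewrite elin ez.
have /choice[zs hzs] (i : 'I_n) := skew_solution cK hKs usp (lam i).
have szs i : sigma (zs i) = zs i.
  have [l0|l0] := boolP (vge v 0 (lam i)); first exact: (inertia_fixes_integral cK hvs usp hs (hzs i) l0).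
  apply: (upper_inertia_fixes_pole cK hK hKs hvs usp hsig (hzs i) l0).
  (* Only non-integral generators reach this point, and [- v (lam i)] is at most their height. *)
  rewrite lerD2r; apply: le_trans (le_bigmax _ _ i).
  rewrite /height; case: eqVneq => [l00|_]; first by rewrite l00 vge0 in l0.
  by rewrite le_max lexx orbT.
have actE c t : act Fq iK D c t = skew_eval Fq iK (D c) t by [].
have actC c t : act Fq iK D a (act Fq iK D c t) = act Fq iK D c (act Fq iK D a t).
  by rewrite !actE -!(skew_eval_tau_mul cK) -!(dm_M hDm) mulrC.
(* Division by [a] is done generator by generator. As A is commutative, D_a takes the same value at
   [z'] and [z], which therefore differ by a point of D[a]. *)
pose z' := \sum_i act Fq iK D (b i) (zs i).
have sz' : sigma z' = z'.
  rewrite rmorph_sum; apply: eq_bigr => i _.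
  by rewrite actE (skew_eval_morph Fq (D (b i)) (zs i) (i1 := iK) (i2 := iK)) ?szs.
have tors : skew_eval Fq iK (D a) (z - z') = iK 0.
  rewrite (skew_evalB cK) -!actE Lz rmorph0 /z' actE (skew_eval_sumr cK).
  apply/eqP; rewrite subr_eq0; apply/eqP/eq_bigr => i _.
  by rewrite -actE actC !actE hzs.
have := inertia_fixes_integral cK hvs usp hs tors (vge0 v 0).
by rewrite rmorphB sz' => /addIr.
Qed.
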